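(* Let $k\in\mathbb{N}$, let $f:\mathbf{S}_k\times\mathbf{S}\to\{0,1\}$ be measurable, and for $\xi\in\mathbf{S}$ set $$F(\xi) := \sum_{\{\psi \subset \xi:\,|\psi| =k\}} f(\psi,\xi \setminus \psi).$$ Let $s >0$ and let $W := F(\eta_s)$. For $x_1,\ldots,x_k \in \mathbb{X}$ set $$p(x_1,\ldots,x_k) := \mathbb{E}\, f(\{(x_1,\tau_1),\ldots,(x_k,\tau_k)\}, \eta_s),$$ and set $\lambda := s \mu$. Suppose that $w: \mathbb{X}^k \to [0,\infty)$ is a measurable function, and that for $\lambda^k$-almost every $\mathbf{x} = (x_1,\ldots,x_k) \in \mathbb{X}^k$ with $p(x_1,\ldots,x_k) >0$ we can find coupled random variables $U_{\mathbf{x}},V_{\mathbf{x}}$ (i.e. defined on a common probability space) such that (i) $\mathcal{L}(U_{\mathbf{x}}) = \mathcal{L}(W)$; (ii) $\mathcal{L}(1+ V_{\mathbf{x}}) = \mathcal{L}\big(F( \bigcup_{i=1}^k \{(x_i,\tau_i)\} \cup \eta_s ) \,\big|\, f(\bigcup_{i=1}^k \{(x_i,\tau_i) \} ,\eta_s) =1 \big)$; (iii) $\mathbb{E} [ |U_{\mathbf{x}} - V_{\mathbf{x}}|] \leq w(\mathbf{x})$. Set $\alpha = \mathbb{E}\, W = (1/k!)\int p(\mathbf{x})\, \lambda^k ( d\mathbf{x})$. Then $$d_{TV}(\mathcal{L}(W),\mathcal{L}(Z_\alpha)) \leq \frac{ 1 \wedge \alpha^{-1} }{k!} \int w(\mathbf{x})\,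 p(\mathbf{x})\, \lambda^k (d\mathbf{x}),$$ and $$d_{W}(\mathcal{L}(W),\mathcal{L}(Z_\alpha)) \leq \frac{ 3 ( 1 \wedge \alpha^{-1/2}) }{k!} \int w(\mathbf{x})\, p(\mathbf{x})\, \lambda^k (d\mathbf{x}).$$
   Context: $(\mathbb{X},\mathcal{F},\mu)$ is an arbitrary probability space. $(\mathbb{M},\mathcal{M},\mathbf{m})$ is a probability space (the mark space) with $\mathbf{m}$ diffuse, meaning that there is a product-measurable set $A\subset\mathbb{M}\times\mathbb{M}$ with $(\mathbf{m}\otimes\mathbf{m})(A)=0$ that contains the diagonal $\{(t,t):t\in\mathbb{M}\}$. $\mathbf{S}$ is the space of all finite subsets of $\mathbb{X}\times\mathbb{M}$, equipped with the smallest $\sigma$-algebra containing the sets $\{\xi\in\mathbf{S}: |\xi\cap B|=m\}$ for all $B\in\mathcal{F}\otimes\mathcal{M}$ and $m\in\mathbb{N}_0$, where $|\cdot|$ is the number of elements; $\mathbf{S}_k:=\{\xi\in\mathbf{S}:|\xi|=k\}$ (with the trace $\sigma$-algebra). Let $(X_i,T_i)$, $i\ge1$, be independent random elements of $\mathbb{X}\times\mathbb{M}$ with common distribution $\mu\otimes\mathbf{m}$; let $N_s$ be a Poisson random variable with mean $s$; and let $\tau_1,\tau_2,\ldots$ be independent random elements of $\mathbb{M}$ with common distribution $\mathbf{m}$; all of these independent of each other. Then $\eta_s:=\bigcup_{i=1}^{N_s}\{(X_i,T_i)\}$, a Poisson point process in $\mathbb{X}\times\mathbb{M}$ with mean measure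 $s\mu\otimes\mathbf{m}$. By diffuseness, the values of all $T_i$ and $\tau_i$ are almost surely distinct. $\mathcal{L}(\cdot)$ denotes the law of a random variable, and $\mathcal{L}(\cdot\mid E)$ its conditional law given the event $E$. $Z_\alpha$ is a Poisson random variable with parameter $\alpha$. $a\wedge b=\min(a,b)$. In the degenerate case $\alpha=0$, $Z_0:=0$ and $1\wedge 0^{-1}=1\wedge 0^{-1/2}:=1$. For $\mathbb{N}_0$-valued random variables $X,Y$, $$d_{TV}(\mathcal{L}(X),\mathcal{L}(Y)) = \sup_{A\subset\mathbb{N}_0}(\mathbb{P}[X\in A]-\mathbb{P}[Y\in A]),$$ $$d_W(\mathcal{L}(X),\mathcal{L}(Y)) = \sup\{|\mathbb{E}h(X)-\mathbb{E}h(Y)| : h:\mathbb{N}_0\to\mathbb{R},\ \sup_{i\in\mathbb{N}_0}|h(i+1)-h(i)|\le 1\}.$$ *)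

(* Defs.v *)
From HB Require Import structures.
From mathcomp Require Import all_boot all_order all_algebra finmap.
From mathcomp Require Import all_classical all_reals all_analysis.

Set Implicit Arguments.
Unset Strict Implicit.
Unset Printing Implicit Defensive.

Import Order.TTheory GRing.Theory Num.Theory.
Import numFieldNormedType.Exports.

Local Open Scope classical_set_scope.
Local Open Scope ring_scope.

Definition diffuse d (M : measurableType d) (R : realType)
    (m : probability M R) : Prop :=
  exists A : set (M * M),
    [/\ measurable A, (m \x m)%E A = 0%E & forall t, A (t, t)].

Section configurations.
Context d (T : measurableType d).

Definition counting_events : set (set {fset T}) :=
  [set E | exists (B : set T) (n : nat), measurable B /\
    E = [set xi | #|` [fset z in xi | z \in B]%fset| = n]].

Definition config : Type := g_sigma_algebraType counting_events.

HB.instance Definition _ := Measurable.on config.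

(* Only the values of [f] on pairs whose first component has [k] points are
   used, so [f] stands for a function on S_k * S. *)
Definition subset_count (k : nat) (f : config -> config -> bool)
    (xi : config) : nat :=
  (\sum_(psi <- fpowerset xi | #|` psi| == k) f psi (xi `\` psi)%fset)%N.

End configurations.

Section tuple_power.
Context d (T : measurableType d) (R : realType).
Local Open Scope ereal_scope.

Lemma measurable_tuple_cons k : measurable_fun setT
  (fun p : T * k.-tuple T => [tuple of p.1 :: p.2] : k.+1.-tuple T).
Proof. exact: measurable_cons. Qed.

Definition tuple_consm (m : set T -> \bar R) k (m' : set (k.-tuple T) -> \bar R) :
    set (k.+1.-tuple T) -> \bar R :=
  pushforward (m \x m') (fun p : T * k.-tuple T => [tuple of p.1 :: p.2]).

Section tuple_consm_finite.
Variables (m : {finite_measure set T -> \bar R}) (k : nat).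
Variable m' : {finite_measure set (k.-tuple T) -> \bar R}.

Let preimage_cons A : measurable A ->
  measurable ((fun p : T * k.-tuple T => [tuple of p.1 :: p.2]) @^-1` A).
Proof. by move=> mA; rewrite -[X in measurable X]setTI; exact: measurable_tuple_cons. Qed.

Let tuple_consm0 : tuple_consm m m' set0 = 0.
Proof. by rewrite /tuple_consm /pushforward preimage_set0 measure0. Qed.

Let tuple_consm_ge0 A : 0 <= tuple_consm m m' A.
Proof. exact: (measure_ge0 (m \x m')). Qed.

Let tuple_consm_sigma_additive : semi_sigma_additive (tuple_consm m m').
Proof.
move=> F mF tF mUF; rewrite /tuple_consm /pushforward preimage_bigcup.
apply: measure_semi_sigma_additive.
- by move=> n; exact: preimage_cons.
- apply/trivIsetP => /= i j _ _ ij; rewrite -preimage_setI.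
  by move/trivIsetP : tF => /(_ _ _ _ _ ij) ->//; rewrite preimage_set0.
- by rewrite -preimage_bigcup; exact: preimage_cons.
Qed.

HB.instance Definition _ := isMeasure.Build _ _ _ (tuple_consm m m')
  tuple_consm0 tuple_consm_ge0 tuple_consm_sigma_additive.

Let tuple_consm_fin_num : fin_num_fun (tuple_consm m m').
Proof.
apply: lty_fin_num_fun.
have mass : tuple_consm m m' setT = m setT * m' setT.
  by rewrite /tuple_consm /pushforward preimage_setT -setXTT product_measure1E.
rewrite -[ltLHS]/(tuple_consm m m' setT) mass.
by rewrite lte_mul_pinfty// ?fin_num_measure// -ge0_fin_numE// fin_num_measure.
Qed.

HB.instance Definition _ :=
  @Measure_isFinite.Build _ _ _ (tuple_consm m m') tuple_consm_fin_num.

End tuple_consm_finite.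

(* The k-fold product measure on the product sigma-algebra of k.-tuple T. *)
Fixpoint tuple_power (m : set T -> \bar R) (k : nat) {struct k} :
    set (k.-tuple T) -> \bar R :=
  match k with
  | 0 => \d_[tuple]
  | k'.+1 => tuple_consm m (@tuple_power m k')
  end.

Arguments tuple_power : clear implicits.

Variable m : {finite_measure set T -> \bar R}.

Let tuple_power_finite k :
  exists m' : {finite_measure set (k.-tuple T) -> \bar R}, tuple_power m k = m'.
Proof.
elim: k => [|k [m' IH]] /=.
  by exists (\d_[tuple] : {finite_measure set (0.-tuple T) -> \bar R}).
by rewrite IH; exists (tuple_consm m m' : {finite_measure set _ -> \bar R}).
Qed.

Let tuple_power0 k : tuple_power m k set0 = 0.
Proof. by have [m' ->] := tuple_power_finite k; exact: measure0. Qed.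

Let tuple_power_ge0 k A : 0 <= tuple_power m k A.
Proof. by have [m' ->] := tuple_power_finite k; exact: measure_ge0. Qed.

Let tuple_power_sigma_additive k : semi_sigma_additive (tuple_power m k).
Proof.
by have [m' ->] := tuple_power_finite k; exact: measure_semi_sigma_additive.
Qed.

HB.instance Definition _ k := isMeasure.Build _ _ _ (tuple_power m k)
  (tuple_power0 k) (@tuple_power_ge0 k) (@tuple_power_sigma_additive k).

Let tuple_power_fin_num k : fin_num_fun (tuple_power m k).
Proof. by have [m' ->] := tuple_power_finite k; exact: fin_num_measure. Qed.

HB.instance Definition _ k :=
  @Measure_isFinite.Build _ _ _ (tuple_power m k) (@tuple_power_fin_num k).

End tuple_power.
Arguments tuple_power {d T R} m k.

Section probability_notions.
Context d (Omega : measurableType d) (R : realType) (P : probability Omega R).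
Local Open Scope ereal_scope.

Definition mutually_independent (I : eqType) (G : I -> set (set Omega)) : Prop :=
  forall (J : seq I) (E : I -> set Omega), uniq J ->
    (forall i, i \in J -> G i (E i)) ->
    P (\bigcap_(i in [set` J]) E i) = \prod_(i <- J) P (E i).

(* Random finite sets built from points that are only almost surely distinct
   need not be measurable, but they agree with measurable ones outside a null
   set. The integral of an indicator is the inner measure of the event: it is
   [P E] when [E] is measurable and does not change when [E] is modified inside
   a null set. *)
Definition prob (E : set Omega) : \bar R := 'E_P[\1_E].

Definition law (Y : Omega -> nat) : set nat -> \bar R :=
  fun A => prob (Y @^-1` A).

Definition cond_law (Y : Omega -> nat) (E : set Omega) : set nat -> \bar R :=
  fun A => ((fine (prob E))^-1)%:E * prob (Y @^-1` A `&` E).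

End probability_notions.

Section distances.
Context (R : realType).
Local Open Scope ereal_scope.
Implicit Types nu : set nat -> \bar R.

Definition dTV nu1 nu2 : \bar R := ereal_sup [set nu1 A - nu2 A | A in setT].

Definition dW nu1 nu2 : \bar R :=
  ereal_sup [set `|\int[nu1]_n (h n)%:E - \int[nu2]_n (h n)%:E| |
             h in [set h : nat -> R | forall i, (`|h i.+1 - h i| <= 1)%R]].

(* [1 /\ x^-1], with value [1] at [x = 0] where the library has [0^-1 = 0]. *)
Definition min1V (x : R) : R := (if x == 0 then 1 else Num.min 1 x^-1)%R.

End distances.

Section marked_sample.
Context dO dX dM (Omega : measurableType dO) (X : measurableType dX)
  (M : measurableType dM).
Variables (XT : nat -> Omega -> X * M) (N : Omega -> nat)
  (tau : nat -> Omega -> M).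

Definition sources (i : nat + unit + nat) : set (set Omega) :=
  match i with
  | inl (inl i) => preimage_set_system setT (XT i) measurable
  | inl (inr _) => preimage_set_system setT N measurable
  | inr j => preimage_set_system setT (tau j) measurable
  end.

Definition poisson_process (o : Omega) : config (X * M)%type :=
  [fset XT i o | i in iota 0 (N o)]%fset.

Definition marked_points (k : nat) (x : k.-tuple X) (o : Omega) :
    config (X * M)%type :=
  [fset (tnth x i, tau i o) | i in 'I_k]%fset.

End marked_sample.

(* Main.v *)
(* Stein's method: for [h] on the naturals the equation
   [a g(n+1) - n g(n) = h(n) - E h(Z_a)] has a solution [g] whose increments at
   positive arguments are at most [min(1, 1/a)] when [h] is an indicator and at most
   [3 min(1, a^(-1/2))] when [h] is 1-Lipschitz. The Mecke equation writes
   [E (W g(W))] as [1/k!] times the integral over [x] of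
   [E (f(x_tau, eta) g(F(x_tau + eta)))] = [p(x) E g(1 + V_x)], where [x_tau] is [x]
   with independent marks, and [a E g(W+1)] as [1/k!] times the integral of
   [p(x) E g(1 + U_x)]; the integrands differ by at most the bound on the increments
   of [g] times [p(x) w(x)]. *)

(* Where marks coincide, the count [W] need not be measurable, yet the integrals of the theorem are
   taken of such functions as they stand. Diffuseness supplies a null set outside which all marks
   are distinct. There, on [N = n], a configuration is the image of an [n]-tuple and its subsets
   correspond to index sets, so every integral reduces to integrals over finite product measures. In
   that form the Mecke equation is exchangeability together with
   [pmf(n+k) C(n+k,k) = s^k / k! pmf(n)].

   A 1-Lipschitz [h] may be unbounded, and its Stein solution is then an infinite series. Replacing
   [h(n)] by [h(min(n,L))] makes it a finite combination of the solutions for the half-lines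
   [n > l], with bounds free of [L]. For half-lines everything is explicit in [u = E (Z - j)^+] and
   [v = E (j - Z)^+]: the Lipschitz increments are at most [2 u v / (a^2 pi)], and the constant 3
   comes from [2 u v <= 3 a^(3/2) pi]. *)
Require Import Defs.
From Stdlib Require Import Field ZArith.
From HB Require Import structures.
From mathcomp Require Import all_boot all_order all_algebra fingroup perm finmap.
From mathcomp Require Import all_classical all_reals all_analysis.
From mathcomp Require Import measurable_realfun.
From mathcomp Require Import ssrZ zify.

Set Implicit Arguments.
Unset Strict Implicit.
Unset Printing Implicit Defensive.

Import Order.TTheory GRing.Theory Num.Theory.
Import numFieldNormedType.Exports.

Local Open Scope classical_set_scope.
Local Open Scope ring_scope.

(** * Ring and field normalisation over a real type *)

(* [ring] and [field] need subtraction and division as binary operations, whereas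
   [x - y] and [x / y] stand for [x + - y] and [x * y^-1]; [field_canon] rewrites
   a term with the operations below. *)
Section ring_setup.
Variable (F : realType).
Definition Fadd (x y : F) : F := x + y.
Definition Fmul (x y : F) : F := x * y.
Definition Fsub (x y : F) : F := x - y.
Definition Fdiv (x y : F) : F := x / y.
Definition Fopp (x : F) : F := - x.
Definition Finv (x : F) : F := x^-1.
Definition Fexp (x : F) (n : nat) : F := x ^+ n.
Definition Fint (z : Z) : F := (int_of_Z z)%:~R.

Lemma F_field_theory : field_theory (0 : F) (1 : F) Fadd Fmul Fsub Fopp Fdiv Finv eq.
Proof.
split => //.
- split => //; [exact: add0r|exact: addrC|exact: addrA|exact: mul1r|
    exact: mulrC|exact: mulrA|exact: mulrDl|exact: subrr].
- by apply/eqP; exact: oner_neq0.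
- by move=> p /eqP; exact: mulVf.
Qed.

Lemma F_morph : ring_morph (0 : F) (1 : F) Fadd Fmul Fsub Fopp eq
  Z0 (Zpos xH) Z.add Z.mul Z.sub Z.opp Z.eqb Fint.
Proof.
split => //.
- by move=> x y; rewrite /Fint /Fadd -intrD -rmorphD.
- by move=> x y; rewrite /Fint /Fsub -intrB -rmorphB.
- by move=> x y; rewrite /Fint /Fmul -intrM -rmorphM.
- by move=> x; rewrite /Fint /Fopp -mulrNz -rmorphN.
- by move=> x y /Z.eqb_eq ->.
Qed.

Lemma F_power : power_theory (1 : F) Fmul eq nat_of_N Fexp.
Proof.
split => x [|n] //=; elim/Pos.peano_ind: n => //= p.
rewrite /Fexp Pos2Nat.inj_succ exprS => ->.
by rewrite pow_pos_succ //; exact: mulrA.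
Qed.
End ring_setup.

Lemma Fint_neq0 (F : realType) z : z <> Z0 -> Fint F z <> 0.
Proof.
move=> z0; apply/eqP; rewrite /Fint intr_eq0; apply/eqP.
by case: z z0 => // p _ /=; lia.
Qed.

Ltac nat_cst t :=
  match t with
  | O => constr:(N0)
  | S ?n => let n := nat_cst n in
    lazymatch n with
    | InitialRing.NotConstant => n
    | _ => eval compute in (N.succ n)
    end
  | _ => constr:(InitialRing.NotConstant)
  end.

Ltac field_cst t :=
  match t with
  | Fint _ ?z => z
  | _ => constr:(InitialRing.NotConstant)
  end.

Ltac field_canon F t :=
  match t with
  | @GRing.add _ ?x (@GRing.opp _ ?y) =>
      let x := field_canon F x in let y := field_canon F y in constr:(@Fsub F x y)
  | @GRing.add _ ?x ?y =>
      let x := field_canon F x in let y := field_canon F y in constr:(@Fadd F x y)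
  | @GRing.mul _ ?x (@GRing.inv _ ?y) =>
      let x := field_canon F x in let y := field_canon F y in constr:(@Fdiv F x y)
  | @GRing.mul _ ?x ?y =>
      let x := field_canon F x in let y := field_canon F y in constr:(@Fmul F x y)
  | @GRing.opp _ ?x => let x := field_canon F x in constr:(@Fopp F x)
  | @GRing.inv _ ?x => let x := field_canon F x in constr:(@Finv F x)
  | @GRing.exp _ ?x ?n =>
    let m := nat_cst n in
    match m with
    | InitialRing.NotConstant => constr:(@GRing.exp F x n)
    | _ => let x := field_canon F x in constr:(@Fexp F x n)
    end
  | @GRing.zero _ => constr:(@Fint F Z0)
  | @GRing.one _ => constr:(@Fint F (Zpos xH))
  | @GRing.natmul _ (@GRing.one _) ?n =>
    let m := nat_cst n in
    match m with
    | InitialRing.NotConstant => constr:(@GRing.natmul F (@GRing.one F) n)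
    | _ => let z := eval compute in (Z.of_N m) in constr:(@Fint F z)
    end
  | _ => t
  end.

Ltac field_prepare F :=
  match goal with |- @eq _ ?x ?y =>
    let x' := field_canon F x in let y' := field_canon F y in
    change (@eq (Real.sort F) x' y')
  end.

Ltac rring F := field_prepare F; ring.
Ltac rfield F := field_prepare F; field; repeat split;
  try (apply: Fint_neq0; discriminate);
  rewrite ?/Fint ?/Fadd ?/Fmul ?/Fsub ?/Fdiv ?/Fopp ?/Finv ?/Fexp;
  try assumption.

(** * Inequalities and equations from explicit certificates *)

Section linear_combinations.
Context (R : numDomainType).
Implicit Types x y l r c e : R.

(** Here [e] is a certificate, a sum of products of quantities known to be nonnegative; its equality
    with [y - x] is left to ring normalisation. *)
Lemma le_by e x y : 0 <= e -> y - x = e -> x <= y.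
Proof. by move=> e0 E; rewrite -subr_ge0 E. Qed.

(** Uses the relation [l = r] with multiplier [c], which reduces an equation modulo a relation such
    as [poisson_pmfS] to an algebraic identity. *)
Lemma eq_by c l r x y : l = r -> x - y = c * (l - r) -> x = y.
Proof. by move=> -> E; apply/eqP; rewrite -subr_eq0 E subrr mulr0. Qed.

Lemma ge0B x y : x <= y -> 0 <= y - x. Proof. by rewrite subr_ge0. Qed.
End linear_combinations.

(** * Stein's equation for the Poisson distribution *)

Lemma ler_cvgn_near (R : realType) (u v : R ^nat) (x y : R) (n0 : nat) :
  u @ \oo --> x -> v @ \oo --> y ->
  (forall n, (n0 <= n)%N -> u n <= v n) -> x <= y.
Proof.
move=> ux vy uv; apply: (ler_cvg_to ux vy).
by exists n0.
Qed.

Section stein_poisson.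
Context (R : realType) (a : R).
Hypothesis a_gt0 : 0 < a.
Implicit Types (i j l m n L : nat).

Add Field Rfield : (@F_field_theory R)
  (morphism (@F_morph R), constants [field_cst], power_tac (@F_power R) [nat_cst]).

Local Notation pi := (poisson_pmf a).

Definition poisson_below n : R := \sum_(0 <= m < n) pi m.
Definition poisson_above n : R := 1 - poisson_below n.
Local Notation S := poisson_below.
Local Notation T := poisson_above.

(* For [Z] Poisson with mean [a]: [E (j - Z)^+] and [E (Z - j)^+]. *)
Definition poisson_deficit j : R := j%:R * S j.+1 - a * S j.
Definition poisson_excess j : R := a * T j - j%:R * T j.+1.
Local Notation v := poisson_deficit.
Local Notation u := poisson_excess.

Lemma poisson_pmf_gt0 n : 0 < pi n.
Proof.
rewrite /poisson_pmf a_gt0 !mulr_gt0// ?exprn_gt0 ?invr_gt0 ?ltr0n ?fact_gt0//.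
exact: expR_gt0.
Qed.

Lemma poisson_pmfS n : n.+1%:R * pi n.+1 = a * pi n.
Proof.
rewrite /poisson_pmf a_gt0 factS natrM exprS.
have f0 : (n`!%:R : R) != 0 by rewrite pnatr_eq0 -lt0n fact_gt0.
have n0 : (n.+1%:R : R) != 0 by rewrite pnatr_eq0.
by rfield R; apply/eqP.
Qed.

Lemma poisson_belowS n : S n.+1 = S n + pi n.
Proof. by rewrite /S big_nat_recr. Qed.

Lemma poisson_aboveS n : T n.+1 = T n - pi n.
Proof. by rewrite /T poisson_belowS; rring R. Qed.

Lemma poisson_below0 : S 0 = 0.
Proof. by rewrite /S big_geq. Qed.

Lemma poisson_below_cvg : S @ \oo --> (1 : R).
Proof.
have -> : (1 : R) = expR a * expR (- a) by rewrite expRN mulfV// gt_eqF ?expR_gt0.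
have -> : S = (fun n => series (exp_coeff a) n * expR (- a)).
  apply/funext => n; rewrite /S /series /= mulr_suml.
  by apply: eq_bigr => i _; rewrite /poisson_pmf a_gt0.
by apply: cvgMl; exact: is_cvg_series_exp_coeff.
Qed.

Lemma poisson_pmf_cvg : pi @ \oo --> (0 : R).
Proof.
apply: cvg_series_cvg_0; apply/cvg_ex; exists 1.
exact: poisson_below_cvg.
Qed.

Lemma poisson_below_nd m n : (m <= n)%N -> S m <= S n.
Proof.
elim: n => [|n IH]; first by rewrite leqn0 => /eqP ->.
rewrite leq_eqVlt => /predU1P[->//|]; rewrite ltnS => /IH.
by move=> h; rewrite poisson_belowS (le_trans h)// lerDl ltW// poisson_pmf_gt0.
Qed.

Lemma poisson_below_ge0 n : 0 <= S n.
Proof. by rewrite -poisson_below0 poisson_below_nd. Qed.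

Lemma poisson_below_le1 n : S n <= 1.
Proof.
apply: (@ler_cvgn_near R (cst (S n)) S _ _ n).
- exact: cvg_cst.
- exact: poisson_below_cvg.
- by move=> m; exact: poisson_below_nd.
Qed.

Lemma poisson_above_ge0 n : 0 <= T n.
Proof. by rewrite /T subr_ge0 poisson_below_le1. Qed.

Lemma poisson_above_le1 n : T n <= 1.
Proof. by rewrite /T gerBl poisson_below_ge0. Qed.

Lemma poisson_above_cvg : T @ \oo --> (0 : R).
Proof.
have -> : (0 : R) = 1 - 1 by rewrite subrr.
by apply: cvgB; [exact: cvg_cst|exact: poisson_below_cvg].
Qed.

Lemma poisson_deficitS j : v j.+1 = v j + S j.+1.
Proof.
rewrite /v [S j.+2]poisson_belowS mulrDr poisson_pmfS [S j.+1]poisson_belowS.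
by rewrite -natr1; rring R.
Qed.

Lemma poisson_excessS j : u j = u j.+1 + T j.+1.
Proof.
apply: (eq_by (c := -1) (poisson_deficitS j)).
by rewrite /u /v /T -natr1; rring R.
Qed.

Lemma poisson_deficitE j : v j = \sum_(0 <= l < j) S l.+1.
Proof.
elim: j => [|j IH]; first by rewrite /v poisson_below0 big_geq//; rring R.
by rewrite poisson_deficitS big_nat_recr//= IH.
Qed.

Lemma poisson_deficit_ge0 j : 0 <= v j.
Proof. by rewrite poisson_deficitE sumr_ge0// => l _; exact: poisson_below_ge0. Qed.

Lemma poisson_excess_ge0 j : 0 <= u j.
Proof.
(* By [poisson_pmfS], for [n >= j] this is the sum of [(m - j) * pi m] over [j < m <= n], a partial
   sum of [E (Z - j)^+]. The induction below adds one nonnegative term at a time. *)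
pose w n := a * (S n - S j) - j%:R * (S n.+1 - S j.+1).
have wu : w @ \oo --> u j.
  apply: cvgB; apply: cvgM; try exact: cvg_cst.
    by apply: cvgB; [exact: poisson_below_cvg|exact: cvg_cst].
  apply: cvgB; last exact: cvg_cst.
  by rewrite (cvg_shiftS S); exact: poisson_below_cvg.
apply: (@ler_cvgn_near R (cst 0) w _ _ j _ wu); first exact: cvg_cst.
elim=> [|n IH jn].
  by rewrite leqn0 => /eqP j0; rewrite /w /cst j0 mul0r !subrr mulr0 subrr.
have [jE|nj] := eqVneq j n.+1; first by rewrite /w jE /cst !subrr !mulr0 subrr.
have {}jn : (j <= n)%N by move: jn; rewrite leq_eqVlt (negbTE nj).
have jn' : (j%:R : R) <= n.+1%:R by rewrite ler_nat ltnW.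
apply: (le_by (addr_ge0 (IH jn)
  (mulr_ge0 (ge0B jn') (ltW (poisson_pmf_gt0 n.+1))))).
rewrite /w /cst [S n.+2]poisson_belowS [S n.+1]poisson_belowS.
by apply: (eq_by (c := -1) (poisson_pmfS n)); rring R.
Qed.

Lemma poisson_excess_sub j : u j - v j = a - j%:R.
Proof. by rewrite /u /v /T; rring R. Qed.

Lemma poisson_deficitE_pmf j : v j.+1 = a * pi j + (j.+1%:R - a) * S j.+1.
Proof.
by rewrite /v [S j.+2]poisson_belowS mulrDr poisson_pmfS; rring R.
Qed.

Lemma poisson_excessE_pmf j : u j.+1 = a * pi j + (a - j.+1%:R) * T j.+1.
Proof.
by rewrite /u [T j.+2]poisson_aboveS [_ * (_ - pi _)]mulrBr poisson_pmfS; rring R.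
Qed.

(** Tail bounds of Mills type: this one is [v j >= 0] rewritten, the next one [u j.+1 >= 0]. They
    control the weight of a tail by the mass at its edge. *)
Lemma poisson_below_le j : (a - j%:R) * S j.+1 <= a * pi j.
Proof.
apply: (le_by (poisson_deficit_ge0 j)).
by rewrite /v poisson_belowS; rring R.
Qed.

Lemma poisson_above_le j : (j.+1%:R - a) * T j.+1 <= a * pi j.
Proof.
by apply: (le_by (poisson_excess_ge0 j.+1)); rewrite poisson_excessE_pmf; rring R.
Qed.

Lemma poisson_centered_sum n : \sum_(0 <= m < n.+1) (a - m%:R) * pi m = a * pi n.
Proof.
elim: n => [|n IH]; first by rewrite big_nat1 subr0.
by rewrite big_nat_recr//= IH mulrBl poisson_pmfS; rring R.
Qed.

(** A partial sum of the Poisson variance, which is [a]; the term with [pi n] is the boundary term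
    left by cutting at [n]. *)
Lemma poisson_variance_sum n :
  \sum_(0 <= m < n.+1) (m%:R - a) ^+ 2 * pi m =
    a * S n.+1 + a * pi n * (a - n.+1%:R).
Proof.
elim: n => [|n IH].
  by rewrite big_nat1 /S big_nat1; rring R.
rewrite big_nat_recr//= IH [S n.+2]poisson_belowS -[n.+2%:R]natr1.
by apply: (eq_by (c := n.+1%:R - a) (poisson_pmfS n)); rring R.
Qed.

Lemma quad_ge (c y : R) : 0 < c -> y <= (y + c) ^+ 2 / (4 * c).
Proof.
move=> c0; rewrite ler_pdivlMr ?mulr_gt0//.
by apply: (le_by (sqr_ge0 (y - c))); rring R.
Qed.

Lemma quad_ge0 (c y : R) : 0 < c -> 0 <= (y + c) ^+ 2 / (4 * c).
Proof. by move=> c0; rewrite divr_ge0 ?sqr_ge0 ?mulr_ge0 ?ltW. Qed.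

(* As [y <= (y + c)^2 / 4c], letting [n] tend to infinity bounds
   [E (a - Z)^+] (for [e = -1]) and [E (Z - a)^+] (for [e = 1]) by half the
   standard deviation [c]. *)
Lemma poisson_quad_sum (c e : R) n : c ^+ 2 = a -> 0 < c -> e ^+ 2 = 1 ->
  a <= n.+1%:R ->
  \sum_(0 <= m < n.+1) ((e * (m%:R - a) + c) ^+ 2 / (4 * c)) * pi m
     <= c / 2 - e * (a * pi n) / 2.
Proof.
move=> ca c0 e2 an; have cN0 : c <> 0 by apply/eqP; rewrite gt_eqF.
have c4 : a / (4 * c) = c / 4 by rewrite -ca; rfield R.
have E m : ((e * (m%:R - a) + c) ^+ 2 / (4 * c)) * pi m =
  (4 * c)^-1 * ((m%:R - a)^+2 * pi m) + - (e / 2) * ((a - m%:R) * pi m) +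
    c / 4 * pi m.
  rewrite [LHS](_ : _ = (4 * c)^-1 * (e^+2 * ((m%:R - a)^+2 * pi m))
    + - (e / 2) * ((a - m%:R) * pi m) + c / 4 * pi m); last by rfield R.
  by rewrite e2 mul1r.
rewrite (eq_bigr _ (fun m _ => E m)) !big_split/= -!mulr_sumr -/(S n.+1).
rewrite poisson_variance_sum poisson_centered_sum.
have i0 : 0 <= (4 * c)^-1 by rewrite invr_ge0 mulr_ge0// ltW.
have c40 : 0 <= c / 4 by rewrite divr_ge0// ltW.
have p0 := mulr_ge0 (ltW a_gt0) (ltW (poisson_pmf_gt0 n)).
have S1 := ge0B (poisson_below_le1 n.+1).
apply: (le_by (addr_ge0 (mulr_ge0 i0 (mulr_ge0 p0 (ge0B an)))
  (addr_ge0 (mulr_ge0 c40 S1) (mulr_ge0 c40 S1)))).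
by apply: (eq_by (c := - S n.+1) c4); rfield R.
Qed.

Lemma poisson_deficit_le_sqrt (c : R) j : c ^+ 2 = a -> 0 < c -> j%:R <= a ->
  v j <= c / 2.
Proof.
move=> ca c0 ja.
apply: (@ler_cvgn_near R (cst (v j)) (fun n => c / 2 + (a / 2) * pi n) _ _
  (maxn j (Num.bound a))).
- exact: cvg_cst.
- rewrite -[X in _ --> X]addr0 -[X in _ + X](mulr0 (a / 2)).
  by apply: cvgD; [exact: cvg_cst|apply: cvgMr; exact: poisson_pmf_cvg].
move=> n; rewrite geq_max => /andP[jn bn].
have an : a <= n.+1%:R.
  rewrite (le_trans (ltW (archi_boundP (ltW a_gt0))))// ler_nat.
  exact: leqW.
have e2 : (-1 : R) ^+ 2 = 1 by rewrite sqrrN expr1n.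
have := poisson_quad_sum ca c0 e2 an.
rewrite mulN1r mulNr opprK [_ * pi n / 2]mulrAC.
apply: le_trans; rewrite /cst.
case: j => [|j] in ja jn *.
  rewrite /v mul0r poisson_below0 mulr0 subrr sumr_ge0// => m _.
  by rewrite mulr_ge0 ?quad_ge0 ?ltW// poisson_pmf_gt0.
(* Only the terms [m <= j] are kept. There [quad_ge] bounds the square below by [a - m]; the sum of
   these is [a * pi j], which dominates [v j.+1] because [j.+1 <= a]. *)
rewrite (big_cat_nat _ (n := j.+1))//=; last exact: (leq_trans jn).
apply: (@le_trans _ _ (a * pi j)); last first.
  rewrite -poisson_centered_sum -[leLHS]addr0 lerD//.
    apply: ler_sum => m _; rewrite ler_pM2r ?poisson_pmf_gt0//.
    by rewrite mulN1r opprB quad_ge.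
  rewrite sumr_ge0// => m _.
  by rewrite mulr_ge0 ?quad_ge0 ?ltW// poisson_pmf_gt0.
rewrite poisson_deficitE_pmf.
apply: (le_by (mulr_ge0 (ge0B ja) (poisson_below_ge0 j.+1))); rring R.
Qed.

Lemma poisson_excess_le_sqrt (c : R) j : c ^+ 2 = a -> 0 < c -> a <= j.+1%:R ->
  u j.+1 <= c / 2.
Proof.
move=> ca c0 ja.
(* For [n > j] this is the sum of [(m - j.+1) * pi m] over [j < m <= n]. As [a <= j.+1], it is at
   most the sum of [(m - a) * pi m] over the same range, to which [quad_ge] applies. *)
pose w n := a * (S n - S j) - j.+1%:R * (S n.+1 - S j.+1).
have wu : w @ \oo --> u j.+1.
  have -> : u j.+1 = a * (1 - S j) - j.+1%:R * (1 - S j.+1).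
    apply: (eq_by (c := 1) (poisson_pmfS j)).
    by rewrite /u /T [S j.+2]poisson_belowS [S j.+1]poisson_belowS; rring R.
  apply: cvgB; apply: cvgM; try exact: cvg_cst.
    by apply: cvgB; [exact: poisson_below_cvg|exact: cvg_cst].
  apply: cvgB; last exact: cvg_cst.
  by rewrite (cvg_shiftS S); exact: poisson_below_cvg.
apply: (ler_cvgn_near (n0 := j.+1) wu (cvg_cst (c / 2))).
move=> n jn.
have an : a <= n.+1%:R by rewrite (le_trans ja)// ler_nat ltnW.
have := poisson_quad_sum ca c0 (expr1n _ _) an.
rewrite mul1r => H.
have {H} : \sum_(0 <= m < n.+1) ((1 * (m%:R - a) + c) ^+ 2 / (4 * c)) * pi m <= c / 2.
  apply: (le_trans H); rewrite gerBl divr_ge0// mulr_ge0 ?ltW//.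
  exact: poisson_pmf_gt0.
apply: le_trans; rewrite (big_cat_nat _ (n := j.+1))//=; last exact: ltnW.
rewrite -[leLHS]add0r lerD//.
  rewrite sumr_ge0// => m _.
  by rewrite mulr_ge0 ?quad_ge0 ?ltW// poisson_pmf_gt0.
apply: (@le_trans _ _ (\sum_(j.+1 <= m < n.+1) (m%:R - a) * pi m)); last first.
  by apply: ler_sum => m _; rewrite ler_pM2r ?poisson_pmf_gt0// mul1r quad_ge.
elim: n jn {an} => [//|n IH]; rewrite leq_eqVlt => /predU1P[[<-]|].
  rewrite big_nat1 /w [S j.+2]poisson_belowS [S j.+1]poisson_belowS.
  apply: (le_by (mulr_ge0 (ge0B ja) (ltW (poisson_pmf_gt0 j.+1)))).
  by apply: (eq_by (c := 1) (poisson_pmfS j)); rring R.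
rewrite ltnS => jn; rewrite big_nat_recr//=; last exact: ltnW.
have {}IH := IH jn; move: IH.
set sg := (X in _ <= X -> _) => IH; rewrite -/sg.
apply: (le_by (addr_ge0 (ge0B IH)
  (mulr_ge0 (ge0B ja) (ltW (poisson_pmf_gt0 n.+1))))).
rewrite /w [S n.+2]poisson_belowS [S n.+1]poisson_belowS.
by apply: (eq_by (c := 1) (poisson_pmfS n)); rring R.
Qed.

(** The bound [poisson_below_le] is used twice: summed over [l <= j], where [a - l >= a - j], and
    once more at [j]. *)
Lemma poisson_deficit_tail j : j%:R <= a ->
  v j.+1 * (a - j%:R) ^+ 2 <= a ^+ 2 * pi j.
Proof.
move=> ja.
have H : v j.+1 * (a - j%:R) <= a * S j.+1.
  rewrite poisson_deficitE mulr_suml /S mulr_sumr.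
  rewrite !big_nat; apply: ler_sum => l /andP[_ lj].
  have lj' : (l%:R : R) <= j%:R by rewrite ler_nat -ltnS.
  rewrite mulrC; apply: le_trans (poisson_below_le l).
  by rewrite ler_wpM2r ?poisson_below_ge0// lerB.
apply: (le_by (addr_ge0 (mulr_ge0 (ge0B ja) (ge0B H))
  (mulr_ge0 (ltW a_gt0) (ge0B (poisson_below_le j))))).
by rring R.
Qed.

(** Here [poisson_above_le] is used twice, summed over [l > j] and then at [j]. The sum is infinite,
    hence the finite version [H] and a limit; the smallest factor in it is [j.+2 - a]. *)
Lemma poisson_excess_tail j : a <= j.+1%:R ->
  u j.+1 * (j.+2%:R - a) * (j.+1%:R - a) <= a ^+ 2 * pi j.
Proof.
move=> ja.
have H n : (u j.+1 - u (j.+1 + n)) * (j.+2%:R - a) <= a * (S (j.+1 + n) - S j.+1).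
  elim: n => [|n IH]; first by rewrite addn0 !subrr mul0r mulr0.
  rewrite addnS; have := poisson_above_le (j.+1 + n).
  have jn : j.+2%:R <= (j.+1 + n).+1%:R :> R by rewrite ler_nat ltnS leq_addr.
  move=> /ge0B H1.
  apply: (le_by (addr_ge0 (ge0B IH) (addr_ge0 H1
    (mulr_ge0 (poisson_above_ge0 (j.+1 + n).+1) (ge0B jn))))).
  rewrite [S (j.+1 + n).+1]poisson_belowS.
  apply: (eq_by (c := a - j.+2%:R) (poisson_excessS (j.+1 + n))).
  by rring R.
have ja2 : a <= j.+2%:R by rewrite (le_trans ja)// ler_nat.
have ub n : u n.+1 <= a * T n.+1.
  apply: (le_by (mulr_ge0 (ler0n R n.+1) (poisson_above_ge0 n.+2))).
  by rewrite /u; rring R.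
have H2 : u j.+1 * (j.+2%:R - a) <= a * T j.+1.
  apply: (@ler_cvgn_near R (cst (u j.+1 * (j.+2%:R - a)))
    (fun n => a * T j.+1 + (a * (j.+2%:R - a)) * T n) _ _ j.+1).
  - exact: cvg_cst.
  - rewrite -[X in _ --> X]addr0 -[X in _ --> _ + X](mulr0 (a * (j.+2%:R - a))).
    by apply: cvgD; [exact: cvg_cst|apply: cvgMr; exact: poisson_above_cvg].
  move=> n jn; rewrite /cst.
  have := H (n - j.+1)%N; rewrite subnKC// => /ge0B H3.
  have {}ub : u n <= a * T n by case: n jn {H3} => // n _; exact: ub.
  apply: (le_by (addr_ge0 H3 (addr_ge0 (mulr_ge0 (ltW a_gt0) (poisson_above_ge0 n))
    (mulr_ge0 (ge0B ja2) (ge0B ub))))).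
  by rewrite /T; rring R.
apply: (le_by (addr_ge0 (mulr_ge0 (ge0B ja) (ge0B H2))
  (mulr_ge0 (ltW a_gt0) (ge0B (poisson_above_le j))))).
by rring R.
Qed.

(* Below the mean, [v <= c / 2] and [v <= a pi_j], while [u - v = a - (j + 1)]; if
   this exceeds [c], then [poisson_deficit_tail] gives [(u - v) v <= a c pi_j].
   Above the mean [u] and [v] exchange their roles. *)
Lemma poisson_excess_deficit (c : R) j : c ^+ 2 = a -> 0 < c ->
  2 * (u j.+1 * v j.+1) <= 3 * (a * c * pi j).
Proof.
move=> ca c0.
have p0 : 0 <= a * pi j by rewrite mulr_ge0// ltW// poisson_pmf_gt0.
have u0 := poisson_excess_ge0 j.+1; have v0 := poisson_deficit_ge0 j.+1.
have uvE := poisson_excess_sub j.+1.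
have [ja|ja] := leP (j.+1%:R : R) a.
  have vc := poisson_deficit_le_sqrt ca c0 ja.
  have vp : v j.+1 <= a * pi j.
    apply: (le_by (mulr_ge0 (ge0B ja) (poisson_below_ge0 j.+1))).
    by rewrite poisson_deficitE_pmf; rring R.
  have [jc|jc] := leP (a - j.+1%:R) c.
    have uc : u j.+1 <= c + c / 2.
      apply: (le_by (addr_ge0 (ge0B vc) (ge0B jc))).
      by apply: (eq_by (c := -1) uvE); rring R.
    apply: (le_by (addr_ge0 (mulr_ge0 (mulr_ge0 (ler0n _ 2) (ge0B uc)) p0)
      (mulr_ge0 (mulr_ge0 (ler0n _ 2) u0) (ge0B vp)))).
    by rfield R.
  have ja' : (j%:R : R) <= a by rewrite (le_trans _ ja)// ler_nat.
  have jc' : c < a - j%:R by rewrite (lt_le_trans jc)// lerB// ler_nat.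
  have vt := poisson_deficit_tail ja'.
  have H : (a - j.+1%:R) * v j.+1 <= a * c * pi j.
    apply: (@le_trans _ _ ((a - j%:R) * v j.+1)).
      by rewrite ler_wpM2r// lerB// ler_nat.
    rewrite -(ler_pM2r (lt_trans c0 jc')).
    apply: (@le_trans _ _ (a ^+ 2 * pi j)).
      apply: (le_by (ge0B vt)); rring R.
    apply: (le_by (mulr_ge0 (mulr_ge0 p0 (ltW c0)) (ge0B (ltW jc')))).
    by apply: (eq_by (c := a * pi j) ca); rring R.
  (* From [T <= 1] follows [u <= a * pi j + (a - j.+1)], so [2 u v] is at most
     [2 (a pi j) (c / 2) + 2 a c pi j], again [3 a c pi j]. *)
  have T1 := ge0B (poisson_above_le1 j.+1).
  apply: (le_by (addr_ge0 (mulr_ge0 (ler0n _ 2) (ge0B H)) (addr_ge0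
    (mulr_ge0 (ler0n _ 2) (mulr_ge0 p0 (ge0B vc)))
    (mulr_ge0 (ler0n _ 2) (mulr_ge0 (mulr_ge0 (ge0B ja) T1) v0))))).
  rewrite poisson_excessE_pmf; rfield R.
have {}ja := ltW ja.
have uc := poisson_excess_le_sqrt ca c0 ja.
have up : u j.+1 <= a * pi j.
  apply: (le_by (mulr_ge0 (ge0B ja) (poisson_above_ge0 j.+1))).
  by rewrite poisson_excessE_pmf; rring R.
have [jc|jc] := leP (j.+1%:R - a) c.
  have vc : v j.+1 <= c + c / 2.
    apply: (le_by (addr_ge0 (ge0B uc) (ge0B jc))).
    by apply: (eq_by (c := 1) uvE); rring R.
  apply: (le_by (addr_ge0 (mulr_ge0 (mulr_ge0 (ler0n _ 2) (ge0B vc)) p0)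
    (mulr_ge0 (mulr_ge0 (ler0n _ 2) v0) (ge0B up)))).
  by rfield R.
have jc' : c < j.+2%:R - a by rewrite (lt_le_trans jc)// lerB// ler_nat.
have ut := poisson_excess_tail ja.
have H : (j.+1%:R - a) * u j.+1 <= a * c * pi j.
  rewrite -(ler_pM2r (lt_trans c0 jc')).
  apply: (@le_trans _ _ (a ^+ 2 * pi j)).
    apply: (le_by (ge0B ut)); rring R.
  apply: (le_by (mulr_ge0 (mulr_ge0 p0 (ltW c0)) (ge0B (ltW jc')))).
  by apply: (eq_by (c := a * pi j) ca); rring R.
have S1 := ge0B (poisson_below_le1 j.+1).
apply: (le_by (addr_ge0 (mulr_ge0 (ler0n _ 2) (ge0B H)) (addr_ge0
  (mulr_ge0 (ler0n _ 2) (mulr_ge0 p0 (ge0B uc)))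
  (mulr_ge0 (ler0n _ 2) (mulr_ge0 (mulr_ge0 (ge0B ja) S1) u0))))).
rewrite poisson_deficitE_pmf; rfield R.
Qed.

(* Solves the Stein equation of the indicator of [n > l]. *)
Definition stein_above l n : R :=
  if n is i.+1 then
    - ((if (i <= l)%N then T l.+1 * S i.+1 else S l.+1 * T i.+1) / (a * pi i))
  else 0.
Local Notation g := stein_above.

Let pi_neq0 n : pi n <> 0.
Proof. by apply/eqP; rewrite gt_eqF ?poisson_pmf_gt0. Qed.

Let a_neq0 : a <> 0.
Proof. by apply/eqP; rewrite gt_eqF. Qed.

Let natS_neq0 n : n.+1%:R <> 0 :> R.
Proof. by apply/eqP; rewrite pnatr_eq0. Qed.

Lemma stein_aboveE l n :
  a * g l n.+1 - n%:R * g l n = (l < n)%:R - T l.+1.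
Proof.
case: n => [|i].
  rewrite /g /= mul0r subr0 poisson_belowS poisson_below0 add0r.
  by rfield R.
rewrite {1}/g {1}/stein_above.
have pE : pi i.+1 = a * pi i / i.+1%:R.
  by apply: (eq_by (c := i.+1%:R^-1) (poisson_pmfS i)); rfield R.
have pi0 := @pi_neq0 i; have n0 := @natS_neq0 i.
rewrite /g; case: (ltngtP i l) pi0 n0 pE => [il|li|->] pi0 n0 pE.
- rewrite ltnNge il/= sub0r [S i.+2]poisson_belowS pE; rfield R.
- rewrite ltnS ltnW// [T i.+2]poisson_aboveS pE /=.
  by rewrite [T l.+1 in RHS]/poisson_above; rfield R.
- by rewrite ltnS leqnn [T l.+2]poisson_aboveS pE /T /=; rfield R.
Qed.

(** Each increment has a known sign, and its size separates into a tail depending on [l] and a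
    factor depending on [j]; the sums over [l] below can therefore be evaluated. *)
Lemma stein_above_diff l j :
  g l j.+2 - g l j.+1 =
    (if (j < l)%N then - (T l.+1 * v j.+1) else S l.+1 * u j.+1) / (a ^+ 2 * pi j).
Proof.
have pE : pi j.+1 = a * pi j / j.+1%:R.
  by apply: (eq_by (c := j.+1%:R^-1) (poisson_pmfS j)); rfield R.
have pi0 := @pi_neq0 j; have n0 := @natS_neq0 j.
rewrite /g /v /u; case: (ltngtP j l) pi0 n0 pE => [jl|lj|->] pi0 n0 pE.
- by rewrite [S j.+2]poisson_belowS pE; rfield R.
- by rewrite [T j.+2]poisson_aboveS pE; rfield R.
- by rewrite [T l.+2]poisson_aboveS pE /T; rfield R.
Qed.

(** The tails [S l.+1] with [l < i] sum to [v i], the tails [T l.+1] with [l >= i] to at most [u i],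
    and [v i * T i.+1 + u i * S i.+1] is exactly [a * pi i]. *)
Lemma stein_above_bound i L :
  \sum_(0 <= l < L) `|g l i.+1| <= 1.
Proof.
apply: (@le_trans _ _ (\sum_(0 <= l < i + L) `|g l i.+1|)).
  rewrite addnC [leRHS](big_cat_nat _ (n := L))//= ?leq_addr//.
  by rewrite lerDl sumr_ge0.
have p0 : 0 < a * pi i by rewrite mulr_gt0// poisson_pmf_gt0.
have E l : `|g l i.+1| =
    (if (i <= l)%N then T l.+1 * S i.+1 else S l.+1 * T i.+1) / (a * pi i).
  rewrite /g normrN ger0_norm// divr_ge0 ?(ltW p0)//.
  by case: ifP => _; rewrite mulr_ge0 ?poisson_above_ge0 ?poisson_below_ge0.
rewrite (eq_bigr _ (fun l _ => E l)) -mulr_suml ler_pdivrMr// mul1r.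
rewrite (big_cat_nat _ (n := i))//= ?leq_addr//.
rewrite (eq_big_nat _ _ (F2 := fun l => S l.+1 * T i.+1)); last first.
  by move=> l /andP[_ li]; rewrite leqNgt li.
rewrite -mulr_suml -poisson_deficitE.
rewrite [X in _ + X](eq_big_nat _ _ (F2 := fun l => T l.+1 * S i.+1)); last first.
  by move=> l /andP[-> _].
rewrite -mulr_suml.
have Tsum : \sum_(i <= l < i + L) T l.+1 <= u i.
  have -> : \sum_(i <= l < i + L) T l.+1 = u i - u (i + L).
    elim: {p0 E} L => [|L IH]; first by rewrite addn0 big_geq// subrr.
    rewrite addnS big_nat_recr ?leq_addr//= IH.
    by apply: (eq_by (c := -1) (poisson_excessS (i + L))); rring R.
  by rewrite gerBl poisson_excess_ge0.
suff H x : x <= u i -> v i * T i.+1 + x * S i.+1 <= a * pi i by exact: H.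
move=> {}Tsum; apply: (le_by (mulr_ge0 (poisson_below_ge0 i.+1) (ge0B Tsum))).
by rewrite /u /v /T poisson_belowS; rring R.
Qed.

(** Summing the tails as before gives at most [2 u v / (a^2 pi j)] with [u], [v] at [j.+1], and
    [poisson_excess_deficit] turns this into [3 c / a = 3 / c]. *)
Lemma stein_above_diff_bound (c : R) j L : c ^+ 2 = a -> 0 < c ->
  \sum_(0 <= l < L) `|g l j.+2 - g l j.+1| <= 3 / c.
Proof.
move=> ca c0.
apply: (@le_trans _ _ (\sum_(0 <= l < j.+1 + L) `|g l j.+2 - g l j.+1|)).
  rewrite addnC [leRHS](big_cat_nat _ (n := L))//= ?leq_addr//.
  by rewrite lerDl sumr_ge0.
have p0 : 0 < a ^+ 2 * pi j by rewrite mulr_gt0 ?exprn_gt0// poisson_pmf_gt0.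
have E l : `|g l j.+2 - g l j.+1| =
    (if (j < l)%N then T l.+1 * v j.+1 else S l.+1 * u j.+1) / (a ^+ 2 * pi j).
  rewrite stein_above_diff normrM [X in _ * X]ger0_norm ?invr_ge0 ?(ltW p0)//.
  congr (_ / _); case: ifP => _; rewrite ?normrN ger0_norm// mulr_ge0//.
  - exact: poisson_above_ge0.
  - exact: poisson_deficit_ge0.
  - exact: poisson_below_ge0.
  - exact: poisson_excess_ge0.
rewrite (eq_bigr _ (fun l _ => E l)) -mulr_suml ler_pdivrMr//.
rewrite (big_cat_nat _ (n := j.+1))//= ?leq_addr//.
rewrite (eq_big_nat _ _ (F2 := fun l => S l.+1 * u j.+1)); last first.
  by move=> l /andP[_ li]; rewrite ltnNge -ltnS li.
rewrite -mulr_suml -poisson_deficitE.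
rewrite [X in _ + X](eq_big_nat _ _ (F2 := fun l => T l.+1 * v j.+1)); last first.
  by move=> l /andP[-> _].
rewrite -mulr_suml.
have Tsum : \sum_(j.+1 <= l < j.+1 + L) T l.+1 <= u j.+1.
  have -> : \sum_(j.+1 <= l < j.+1 + L) T l.+1 = u j.+1 - u (j.+1 + L).
    elim: {p0 E} L => [|L IH]; first by rewrite addn0 big_geq// subrr.
    rewrite addnS big_nat_recr ?leq_addr//= IH.
    by apply: (eq_by (c := -1) (poisson_excessS (j.+1 + L))); rring R.
  by rewrite gerBl poisson_excess_ge0.
have cN0 : c <> 0 by apply/eqP; rewrite gt_eqF.
suff H x : x <= u j.+1 ->
    v j.+1 * u j.+1 + x * v j.+1 <= 3 / c * (a ^+ 2 * pi j) by exact: H.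
move=> {}Tsum; apply: (le_by (addr_ge0 (ge0B (poisson_excess_deficit j ca c0))
  (mulr_ge0 (poisson_deficit_ge0 j.+1) (ge0B Tsum)))).
by rewrite -ca; rfield R.
Qed.

(* A function [h] that is constant from [L] on is a combination of the indicators
   of [n > l] with [l < L], and so is the solution of its Stein equation. *)
Definition stein (h : nat -> R) L n : R :=
  \sum_(0 <= l < L) (h l.+1 - h l) * g l n.

(** This is [E h(Z)] for [h] constant from [L] on, because [T l.+1] is the probability of
    [Z > l]. *)
Definition poisson_mean_trunc (h : nat -> R) L : R :=
  h 0%N + \sum_(0 <= l < L) (h l.+1 - h l) * T l.+1.

Section stein.
Variables (h : nat -> R) (L : nat).
Hypothesis h_trunc : forall n, (L <= n)%N -> h n = h L.

Lemma truncE n : h n = h 0%N + \sum_(0 <= l < L) (h l.+1 - h l) * (l < n)%:R.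
Proof.
have H m : (m <= L)%N ->
    \sum_(0 <= l < L) (h l.+1 - h l) * (l < m)%:R = h m - h 0%N.
  move=> mL; rewrite (big_cat_nat _ (n := m))//=.
  rewrite (eq_big_nat _ _ (F2 := fun l => h l.+1 - h l)); last first.
    by move=> l /andP[_ ->]; rewrite mulr1.
  rewrite telescope_sumr// [X in _ + X]big_nat [X in _ + X]big1 ?addr0//.
  by move=> l /andP[ml _]; rewrite ltnNge ml mulr0.
have [nL|Ln] := leqP n L; first by rewrite H// addrC subrK.
rewrite (h_trunc (ltnW Ln)) -{1}(subrK (h 0%N) (h L)) -(H L (leqnn L)) addrC.
congr (_ + _); apply: eq_big_nat => l /andP[_ lL].
by rewrite lL (ltn_trans lL Ln).
Qed.

Lemma steinE n :
  a * stein h L n.+1 - n%:R * stein h L n = h n - poisson_mean_trunc h L.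
Proof.
rewrite (truncE n) /poisson_mean_trunc opprD addrACA subrr add0r.
rewrite /stein !mulr_sumr -!sumrB; apply: eq_bigr => l _.
by apply: (eq_by (c := h l.+1 - h l) (stein_aboveE l n)); rring R.
Qed.

Lemma stein_le1 n : (forall i, `|h i.+1 - h i| <= 1) -> `|stein h L n| <= 1.
Proof.
move=> h1; case: n => [|i].
  rewrite /stein big1 ?normr0// => l _.
  by rewrite /g mulr0.
rewrite (le_trans (ler_norm_sum _ _ _))// (le_trans _ (stein_above_bound i L))//.
by apply: ler_sum => l _; rewrite normrM ler_piMl.
Qed.

Lemma stein_diff_le_lip j : (forall i, `|h i.+1 - h i| <= 1) ->
  `|stein h L j.+2 - stein h L j.+1| <= 3 * min1V (Num.sqrt a).
Proof.
move=> h1; have c0 : 0 < Num.sqrt a by rewrite sqrtr_gt0.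
rewrite /min1V gt_eqF// minr_pMr// mulr1 le_min; apply/andP; split.
  (* For the entry 1 of the minimum the crude bound suffices: two values of modulus at most 1 differ
     by at most 2. *)
  rewrite (le_trans (ler_normB _ _))//.
  rewrite (le_trans (lerD (stein_le1 _ h1) (stein_le1 _ h1)))//.
  by have : (2%:R : R) <= 3%:R by rewrite ler_nat.
rewrite -sumrB (le_trans (ler_norm_sum _ _ _))//.
apply: le_trans (stein_above_diff_bound j L _ c0).
  by apply: ler_sum => l _; rewrite -mulrBr normrM ler_piMl.
by rewrite sqr_sqrtr// ltW.
Qed.

Lemma stein_ext L' n : (L <= L')%N -> stein h L' n = stein h L n.
Proof.
move=> LL; rewrite /stein (big_cat_nat _ (n := L))//=.
rewrite [X in _ + X]big_nat [X in _ + X]big1 ?addr0// => l /andP[Ll _].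
by rewrite (h_trunc Ll) h_trunc ?subrr ?mul0r// (leq_trans Ll).
Qed.

Lemma stein_diff_le_01 j : (forall i, 0 <= h i <= 1) ->
  `|stein h L j.+2 - stein h L j.+1| <= min1V a.
Proof.
move=> h01; set n := j.+1.
have h0 i : 0 <= h i by case/andP: (h01 i).
have h1 i : h i <= 1 by case/andP: (h01 i).
(* Beyond [L], so that [stein_ext] applies, and beyond [n], where the sum is split according to the
   sign of the increments. *)
pose K := (n.+1 + L)%N.
rewrite -!(@stein_ext K) ?leq_addl// /stein -sumrB.
have p0 : 0 < a ^+ 2 * pi j by rewrite mulr_gt0 ?exprn_gt0// poisson_pmf_gt0.
pose D i := h i.+1 - h i.
have -> : \sum_(0 <= l < K) (D l * g l j.+2 - D l * g l j.+1) =
    ((\sum_(0 <= l < n) D l * S l.+1) * u n -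
     (\sum_(n <= l < K) D l * T l.+1) * v n) / (a ^+ 2 * pi j).
  rewrite (eq_bigr (fun l => D l * (if (j < l)%N then - (T l.+1 * v n)
      else S l.+1 * u n) / (a ^+ 2 * pi j))); last first.
    by move=> l _; rewrite -mulrBr stein_above_diff mulrA.
  rewrite -mulr_suml (big_cat_nat _ (n := n))//=; last by rewrite /K addSnnS leq_addr.
  congr (_ / _); rewrite -[X in _ = _ + X]mulNr !mulr_suml -sumrN !mulr_suml.
  congr (_ + _); apply: eq_big_nat => l /andP[nl lK].
    by rewrite ltnNge -ltnS lK/= mulrA.
  by rewrite nl mulrN mulNr mulrA.
(* Summation by parts: the sum is [h n * S n] minus the sum of [h m * pi m] over [m < n], which lies
   between 0 and [S n] as [0 <= h <= 1]. *)
have SS : h n * S n - S n <= \sum_(0 <= l < n) D l * S l.+1 <= h n * S n.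
  elim: {+}n => [|m /andP[IH1 IH2]].
    by rewrite big_geq// poisson_below0 mulr0 subrr lexx.
  rewrite big_nat_recr//=.
  move: (\sum_(0 <= l < m) _) IH1 IH2 => sg IH1 IH2.
  rewrite /D [S m.+1]poisson_belowS.
  have pm := ltW (poisson_pmf_gt0 m); have Sm := poisson_below_ge0 m.
  apply/andP; split.
    apply: (le_by (addr_ge0 (ge0B IH1) (mulr_ge0 pm (ge0B (h1 m))))).
    by rring R.
  apply: (le_by (addr_ge0 (ge0B IH2) (mulr_ge0 pm (h0 m)))).
  by rring R.
(* Likewise, this sum is [h K * T K - h n * T n.+1] plus the sum of [h m * pi m] over
   [n < m < K]. *)
have TT : h K * T K - h n * T n.+1 <= \sum_(n <= l < K) D l * T l.+1 <=
    h K * T K - h n * T n.+1 + T n.+1 - T K.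
  rewrite /K; elim: {K}L => [|m].
    rewrite addn0 big_nat1 /D; apply/andP; split.
      by apply: (le_by (lexx 0)); rring R.
    by apply: (le_by (lexx 0)); rring R.
  rewrite addnS; set k := (n.+1 + m)%N => /andP[IH1 IH2].
  have nk : (n <= k)%N by rewrite /k addSnnS leq_addr.
  rewrite big_nat_recr//=.
  move: (\sum_(n <= l < k) _) IH1 IH2 => sg IH1 IH2.
  rewrite /D [T k.+1]poisson_aboveS.
  have pm := ltW (poisson_pmf_gt0 k).
  apply/andP; split.
    by apply: (le_by (addr_ge0 (ge0B IH1) (mulr_ge0 pm (h0 k)))); rring R.
  apply: (le_by (addr_ge0 (ge0B IH2) (mulr_ge0 pm (ge0B (h1 k))))).
  by rring R.
have u0 := poisson_excess_ge0 n; have v0 := poisson_deficit_ge0 n.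
have TK0 := poisson_above_ge0 K; have Tn0 := poisson_above_ge0 n.+1.
have Sn0 := poisson_below_ge0 n.
pose B := S n * u n + T n.+1 * v n.
move: SS TT; move: (\sum_(0 <= l < n) _) (\sum_(n <= l < K) _) => s t.
move=> /andP[s1 s2] /andP[t1 t2].
have B0 : 0 <= B by rewrite addr_ge0 ?mulr_ge0.
(* The two certificates in fact give the range from [- (1 - h n) * B] to [h n * B], up to terms with
   [T K] of the favourable sign. *)
have sB : `|s * u n - t * v n| <= B.
  rewrite ler_norml; apply/andP; split.
    apply: (le_by (addr_ge0 (addr_ge0 (mulr_ge0 (ge0B s1) u0)
      (mulr_ge0 (ge0B t2) v0)) (addr_ge0 (mulr_ge0 (mulr_ge0 (ge0B (h1 K)) TK0) v0)
        (mulr_ge0 (h0 n) B0)))).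
    by rewrite /B; rring R.
  apply: (le_by (addr_ge0 (addr_ge0 (mulr_ge0 (ge0B s2) u0)
    (mulr_ge0 (ge0B t1) v0)) (addr_ge0 (mulr_ge0 (mulr_ge0 (h0 K) TK0) v0)
      (mulr_ge0 (ge0B (h1 n)) B0)))).
  by rewrite /B; rring R.
rewrite normrM [X in _ * X]ger0_norm ?invr_ge0 ?(ltW p0)// ler_pdivrMr//.
apply: (le_trans sB).
have BE : B = pi n * (a * S n + n%:R * T n.+1).
  by rewrite /B /u /v /T poisson_belowS; rring R.
have aj : a * pi j = n%:R * pi n by rewrite poisson_pmfS.
have pn := ltW (poisson_pmf_gt0 n).
(* The quotient of [B] by [a^2 * pi j] is [(a * S n + n * T n.+1) / (a * n)]. By [u n >= 0] it is at
   most [1 / n <= 1], by [v n >= 0] at most [1 / a]. *)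
rewrite /min1V gt_eqF//; case: (leP 1 a^-1) => _.
  rewrite mul1r expr2 -mulrA aj BE.
  have n1 : (1 : R) <= n%:R by rewrite ler1n.
  apply: (le_by (addr_ge0 (mulr_ge0 pn u0)
    (mulr_ge0 pn (mulr_ge0 (ltW a_gt0) (ge0B n1))))).
  by rewrite /u /T; rring R.
rewrite expr2 -mulrA mulKf ?gt_eqF// aj BE.
apply: (le_by (mulr_ge0 pn v0)).
by rewrite /v /T; rring R.
Qed.

End stein.
End stein_poisson.

(** * Integrals off null sets and measures on tuples *)

Section integral_off_null.
Context d (T : measurableType d) (R : realType) (mu : {measure set T -> \bar R}).
Variable N : set T.
Hypotheses (mN : measurable N) (N0 : mu N = 0%E).
Local Open Scope ereal_scope.
Import HBNNSimple.

Let nnintegral (f : T -> \bar R) := ereal_sup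
  [set sintegral mu h | h in [set h : {nnsfun T >-> R} | forall x, (h x)%:E <= f x]].

(** A simple function below [f] becomes one below [g] when it is set to 0 on [N], which does not
    change its integral. *)
Let nnintegral_le (f g : T -> \bar R) :
  (forall x, 0 <= g x) -> (forall x, ~ N x -> f x = g x) ->
  nnintegral f <= nnintegral g.
Proof.
move=> g0 fg; apply: ub_ereal_sup => _ [h hf <-].
have mC : measurable (~` N) by exact: measurableC.
apply: (@le_trans _ _ (sintegral mu (proj_nnsfun h mC))); last first.
  apply: ereal_sup_ubound; exists (proj_nnsfun h mC) => // x /=.
  rewrite /mindic indicE; have [xN|xN] := pselect (N x).
    by rewrite memNset ?mulr0//= => /(_ xN).
  by rewrite mem_set// mulr1 -fg.
rewrite -!integralT_nnsfun; apply: ae_ge0_le_integral => //.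
- by move=> x _; rewrite lee_fin.
- by apply/measurable_EFinP.
- by move=> x _; rewrite lee_fin.
- by apply/measurable_EFinP.
exists N; split => // x /= /not_implyP[_]; apply: contra_notP => Nx.
by rewrite /mindic indicE mem_set// mulr1.
Qed.

(* Neither [f] nor [g] need be measurable. *)
Lemma integral_off_null (f g : T -> \bar R) :
  (forall x, ~ N x -> f x = g x) -> \int[mu]_x f x = \int[mu]_x g x.
Proof.
move=> fg; rewrite /integral !patch_setT.
congr (_ - _); rewrite -/(nnintegral _) -/(nnintegral _);
  apply/eqP; rewrite eq_le; apply/andP; split;
  apply: nnintegral_le => // x Nx; rewrite ?funepos_ge0 ?funeneg_ge0//.
all: by rewrite ?funeposE ?funenegE fg.
Qed.

End integral_off_null.

(** * Boxes in tuple spaces and uniqueness of measures *)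

Section tuple_boxes.
Context d (T : measurableType d).
Implicit Types n : nat.

Definition box n (B : 'I_n -> set T) : set (n.-tuple T) :=
  [set t | forall i, B i (tnth t i)].

Definition boxes (H : set (set T)) n : set (set (n.-tuple T)) :=
  [set box B | B in [set B : 'I_n -> set T | forall i, H (B i)]].

Lemma measurable_box n (B : 'I_n -> set T) :
  (forall i, measurable (B i)) -> measurable (box B).
Proof.
move=> mB; rewrite (_ : box B = \bigcap_(i in setT) (fun t => tnth t i) @^-1` B i).
  apply: fin_bigcap_measurable => // i _.
  by rewrite -[X in measurable X]setTI; exact: measurable_tnth.
by apply/seteqP; split => [t tB i _|t tB i]; [exact: tB|exact: (tB i)].
Qed.

(** As [H] contains [setT], the preimage of a generator under one coordinate is itself a box. *)
Lemma tuple_measurable_boxes (H : set (set T)) n :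
  measurable = <<s H >> -> H setT ->
  @measurable _ (n.-tuple T) = <<s @boxes H n >>.
Proof.
move=> mH HT; rewrite eqEsubset; split.
  rewrite {1}/measurable /= /g_sigma_preimage.
  apply: smallest_sub; first exact: smallest_sigma_algebra.
  move=> A; rewrite -bigcup_seq => -[i _ [B mB <-]]; rewrite setTI.
  have : <<s preimage_set_system setT (fun t : n.-tuple T => tnth t i) H >>
      ((fun t => tnth t i) @^-1` B).
    have HB : <<s H >> B by rewrite -mH.
    by rewrite g_sigma_preimageE; exists B; rewrite ?setTI.
  apply: smallest_sub; first exact: smallest_sigma_algebra.
  move=> _ [C HC <-]; apply: sub_sigma_algebra; rewrite setTI.
  exists (fun j => if j == i then C else setT).
    by move=> j /=; case: ifP.
  apply/seteqP; split => [t tB|t tC j] /=; first by have := tB i; rewrite eqxx.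
  by case: eqP => [->|].
apply: smallest_sub; first exact: sigma_algebra_measurable.
move=> _ [B HB <-]; apply: measurable_box => i; rewrite mH.
by apply: sub_sigma_algebra; exact: HB.
Qed.

Lemma setI_closed_boxes (H : set (set T)) n :
  setI_closed H -> setI_closed (@boxes H n).
Proof.
move=> HI _ _ [A HA <-] [B HB <-]; exists (fun i => A i `&` B i).
  by move=> i; apply: HI; [exact: HA|exact: HB].
by apply/seteqP; split => [t AB|t [tA tB] i]; [split=> i; case: (AB i)|split].
Qed.

(** The generating class [H] is left open: samples use all measurable sets, whereas tagged samples
    use rectangles in [X * M], on which location and mark factor. *)
Lemma tuple_measure_unique (R : realType) (H : set (set T)) n
    (m1 m2 : {measure set (n.-tuple T) -> \bar R}) :
  measurable = <<s H >> -> H setT -> setI_closed H ->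
  (m1 setT < +oo)%E ->
  (forall B : 'I_n -> set T, (forall i, H (B i)) -> m1 (box B) = m2 (box B)) ->
  forall A, measurable A -> m1 A = m2 A.
Proof.
move=> mH HT HI m1oo m12 A mA.
have bT : boxes H [set: n.-tuple T].
  by exists (fun=> setT) => //; apply/seteqP; split.
apply: (measure_unique (@boxes H n) (fun=> setT)) => //.
- exact: tuple_measurable_boxes.
- exact: setI_closed_boxes.
- by rewrite bigcup_const.
- by move=> _ [B HB <-]; exact: m12.
Qed.

Lemma tuple_power_box (R : realType) (m : {finite_measure set T -> \bar R}) n
    (B : 'I_n -> set T) : (forall i, measurable (B i)) ->
  tuple_power m n (box B) = (\prod_(i < n) m (B i))%E.
Proof.
elim: n B => [|n IH] B mB.
  by rewrite big_ord0 /= diracE mem_set// => -[].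
rewrite big_ord_recl /= /tuple_consm /pushforward.
rewrite (_ : _ @^-1` _ = B ord0 `*` box (fun i => B (lift ord0 i))).
  rewrite -(IH (fun i => B (lift ord0 i)))//.
  rewrite product_measure1E//; exact: measurable_box.
apply/seteqP; split => [[x t] /= xtB|[x t] /= [xB tB] i].
  split; first by have := xtB ord0; rewrite tnth0.
  by move=> i; have := xtB (lift ord0 i); rewrite tnthS.
by case: (unliftP ord0 i) => [j|] ->; rewrite ?tnthS ?tnth0.
Qed.

End tuple_boxes.

(** * Measurability of configurations of distinct points *)

Section finite_dependence.
Context d d' (T : measurableType d) (U : measurableType d').

(** The bits cut [D] into finitely many measurable pieces, on each of which the value is
    constant. *)
Lemma measurable_fun_fin_dep (I : finType) (D : set T) (b : I -> T -> bool)
    (h : {ffun I -> bool} -> U) :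
  (forall i, measurable_fun D (b i)) ->
  measurable_fun D (fun z => h [ffun i => b i z]).
Proof.
move=> mb mD Y mY.
rewrite (_ : _ `&` _ = \bigcup_(phi in [set phi | Y (h phi)])
    (D `&` \bigcap_(i in setT) (D `&` b i @^-1` [set phi i]))).
  apply: fin_bigcup_measurable => // phi _; apply: measurableI => //.
  by apply: fin_bigcap_measurable => // i _; exact: mb.
apply/seteqP; split => [z [Dz Yz]|z [phi Yphi [Dz zphi]]].
  exists [ffun i => b i z] => //; split => // i _; split => //=.
  by rewrite ffunE.
split => //=; rewrite [X in h X](_ : _ = phi)//.
by apply/ffunP => i; rewrite ffunE; have [_ ->] := zphi i Logic.I.
Qed.

Lemma measurable_fun_pair_in d2 (V : measurableType d2) (D : set T)
    (f : T -> U) (g : T -> V) :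
  measurable_fun D f -> measurable_fun D g ->
  measurable_fun D (fun x => (f x, g x)).
Proof.
move=> mf mg mD.
have mdef : @measurable _ (U * V)%type =
  <<s preimage_set_system setT fst measurable `|`
      preimage_set_system setT snd measurable >> by [].
apply: (measurability _ mdef) => // _ [_ [[B mB <-]|[B mB <-]] <-].
  by rewrite setTI; exact: mf.
by rewrite setTI; exact: mg.
Qed.

End finite_dependence.

Section subconfigurations.
Context d (T : measurableType d) (n : nat).
Implicit Types (z : n.-tuple T) (J : {set 'I_n}) (B : set T).

Definition subconfig J z : config T := [fset tnth z i | i in J]%fset.

Lemma in_subconfig z J i : injective (tnth z) ->
  (tnth z i \in subconfig J z) = (i \in J).
Proof.
move=> zi; apply/imfsetP/idP => [[j jJ /zi ->]//|iJ].
by exists i.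
Qed.

Lemma subconfigP z J x :
  reflect (exists2 i, i \in J & x = tnth z i) (x \in subconfig J z).
Proof. by apply: (iffP (imfsetP _ _ _ _)) => -[i iJ ->]; exists i. Qed.

Lemma card_imfset_set z J : injective (tnth z) ->
  #|` [fset tnth z i | i in J]%fset| = #|J|.
Proof.
move=> zi; rewrite card_imfset// [RHS]cardE; apply: perm_size.
by apply: uniq_perm; rewrite ?enum_uniq ?enum_finmem_uniq.
Qed.

Lemma card_subconfig z J : injective (tnth z) -> #|` subconfig J z| = #|J|.
Proof. exact: card_imfset_set. Qed.

Lemma card_subconfig_in z J B (A : {fset T}) : injective (tnth z) ->
  (forall x, (x \in A) = (x \in subconfig J z) && (x \in B)) ->
  #|` A| = #|[set i in J | tnth z i \in B]|.
Proof.
move=> zi AE; rewrite -(card_imfset_set _ zi); congr (#|` _|).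
apply/fsetP => x; rewrite AE; apply/idP/imfsetP.
  by move=> /andP[/subconfigP[i iJ ->] iB]; exists i; rewrite //= inE iJ.
move=> [i /=]; rewrite inE => /andP[iJ iB] ->; rewrite iB andbT.
by apply/subconfigP; exists i.
Qed.

Lemma subconfigC z J : injective (tnth z) ->
  (subconfig [set: 'I_n]%SET z `\` subconfig J z)%fset = subconfig (~: J) z.
Proof.
move=> zi; apply/fsetP => x; rewrite inE.
apply/andP/subconfigP => [[xJ /subconfigP[i _ xE]]|[i iJ ->]].
  by exists i => //; rewrite inE; apply: contra xJ => iJ; rewrite xE in_subconfig.
move: iJ; rewrite inE in_subconfig// => iJ; split=> //.
by apply/subconfigP; exists i; rewrite ?inE.
Qed.

Lemma subconfigU z J :
  subconfig [set: 'I_n]%SET z = (subconfig J z `|` subconfig (~: J) z)%fset.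
Proof.
apply/fsetP => x; rewrite inE; apply/subconfigP/orP => [[i _ ->]|].
  have [iJ|iJ] := boolP (i \in J); [left|right]; apply/subconfigP; exists i => //.
  by rewrite inE.
by case=> /subconfigP[i _ ->]; exists i; rewrite ?inE.
Qed.

Lemma fpowerset_subconfig z : injective (tnth z) ->
  fpowerset (subconfig [set: 'I_n]%SET z) = [fset subconfig J z | J in {set 'I_n}]%fset.
Proof.
move=> zi; apply/fsetP => psi; rewrite fpowersetE; apply/idP/imfsetP.
  move=> psiz; exists [set i | tnth z i \in psi]%SET => //.
  apply/fsetP => x; apply/idP/subconfigP => [xpsi|[i]]; last first.
    by rewrite inE => ? ->.
  have /subconfigP[i _ xE] := fsubsetP psiz _ xpsi.
  by exists i => //; rewrite inE -xE.
move=> [J _ ->]; apply/fsubsetP => x /subconfigP[i _ ->].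
by apply/subconfigP; exists i; rewrite ?inE.
Qed.

(** For distinct points [subconfig] is a bijection from index sets to subsets, so a sum over a
    varying family becomes one over a fixed finite type. *)
Lemma subset_countE k (f : config T -> config T -> bool) z : injective (tnth z) ->
  subset_count k f (subconfig [set: 'I_n]%SET z) =
  (\sum_(J : {set 'I_n} | #|J| == k) f (subconfig J z) (subconfig (~: J) z))%N.
Proof.
move=> zi; rewrite /subset_count fpowerset_subconfig//.
rewrite (perm_big _ (enum_imfset _ _)) /=; last first.
  move=> J K _ _ JK; apply/setP => i.
  by rewrite -(in_subconfig J i zi) -(in_subconfig K i zi) JK.
rewrite big_map; under eq_bigl do rewrite card_subconfig//.
under eq_bigr do rewrite subconfigC//.
rewrite -big_filter -[RHS]big_filter; apply: perm_big; apply: uniq_perm.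
- by rewrite filter_uniq ?enum_uniq.
- by rewrite filter_uniq ?index_enum_uniq.
- by move=> J; rewrite !mem_filter mem_index_enum; congr (_ && _); exact: mem_enum.
Qed.

Section measurability.
Variable E : set (n.-tuple T).
Hypothesis mE : measurable E.
Hypothesis E_inj : forall z, E z -> injective (tnth z).

(** It suffices to treat counting events, and for distinct points the number of points in [B]
    depends only on which coordinates lie in [B]. *)
Lemma measurable_subconfig J : measurable_fun E (subconfig J).
Proof.
have mdef : @measurable _ (config T) = <<s @counting_events _ T >> by [].
apply: (measurability _ mdef) => // _ [_ [B [m [mB ->]]] <-].
have mb i : measurable_fun E (fun z => tnth z i \in B).
  apply: measurable_funTS; apply: (measurableT_comp (f := fun x => x \in B)).
    apply: (measurable_fun_bool true); rewrite setTI.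
    by rewrite (_ : _ @^-1` _ = B)//; apply/seteqP; split => x /=;
      [exact: set_mem|exact: mem_set].
  exact: measurable_tnth.
have := measurable_fun_fin_dep
  (fun phi : {ffun 'I_n -> bool} => #|[set i in J | phi i]| == m) mb mE.
move=> /(_ [set true] Logic.I).
congr (measurable _); apply/seteqP; split => z [Ez zm]; split => //=.
- apply: (etrans (@card_subconfig_in z J B _ (@E_inj _ Ez) _)).
    by move=> x; rewrite !inE.
  move: zm => /= /eqP <-.
  by apply: eq_card => i; rewrite !inE ffunE.
- apply/eqP; move: zm => /= <-.
  apply: (etrans _ (esym (@card_subconfig_in z J B _ (@E_inj _ Ez) _))).
    by apply: eq_card => i; rewrite !inE ffunE.
  by move=> x; rewrite !inE.
Qed.

Lemma measurable_subset_pattern k (f : config T -> config T -> bool) J :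
  measurable_fun ([set psi : config T | #|` psi| = k] `*` setT)
    (fun q => f q.1 q.2) ->
  #|J| = k ->
  measurable_fun E (fun z => f (subconfig J z) (subconfig (~: J) z)).
Proof.
move=> mf Jk.
apply: (measurable_comp (F := [set psi : config T | #|` psi| = k] `*` setT)
  (f := fun q => f q.1 q.2)
  (g := fun z => (subconfig J z, subconfig (~: J) z))) => //.
- apply: measurableX => //; apply: sub_sigma_algebra.
  exists setT, k; split => //; apply/seteqP; split => xi /= <-.
    by congr (#|` _|); apply/fsetP => x; rewrite !inE /= in_setT andbT.
  by congr (#|` _|); apply/fsetP => x; rewrite !inE /= in_setT andbT.
- by move=> _ [z Ez <-] /=; split => //=; rewrite card_subconfig//; exact: E_inj.
by apply: measurable_fun_pair_in; exact: measurable_subconfig.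
Qed.

Lemma measurable_subset_count k (f : config T -> config T -> bool) :
  measurable_fun ([set psi : config T | #|` psi| = k] `*` setT)
    (fun q => f q.1 q.2) ->
  measurable_fun E (fun z => subset_count k f (subconfig [set: 'I_n]%SET z)).
Proof.
move=> mf.
(* Measurability of [f] is given only for first arguments with [k] points, so index sets of other
   sizes receive the value false. *)
pose b (J : {set 'I_n}) z := (#|J| == k) && f (subconfig J z) (subconfig (~: J) z).
have mb J : measurable_fun E (b J).
  rewrite /b; case: eqP => [Jk|_]; last exact: measurable_cst.
  exact: (measurable_subset_pattern mf Jk).
pose h (phi : {ffun {set 'I_n} -> bool}) := (\sum_J phi J)%N.
apply: (eq_measurable_fun (fun z => h [ffun J => b J z])); last first.
  exact: (measurable_fun_fin_dep h mb).
move=> z /set_mem Ez; rewrite (subset_countE _ _ (@E_inj z Ez)) [RHS]big_mkcond/=.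
by apply: eq_bigr => J _; rewrite ffunE /b; case: eqP.
Qed.

End measurability.
End subconfigurations.

Lemma integral_mrestr d (T : measurableType d) (R : realType)
    (mu : {measure set T -> \bar R}) (D : set T) (mD : measurable D)
    (f : T -> \bar R) :
  (\int[mrestr mu mD]_x f x = \int[mu]_(x in D) f x)%E.
Proof.
rewrite (@integral_off_null _ _ _ (mrestr mu mD) (~` D) _ _ _ (f \_ D)).
- rewrite -integral_mkcond; apply: eq_measure_integral => A mA AD.
  by rewrite /= /mrestr setIidl.
- exact: measurableC.
- by rewrite /= /mrestr setICl measure0.
- by move=> x; rewrite /= notK => Dx; rewrite patchE mem_set.
Qed.

(** Change of variables: the image under [Y] of [nu] restricted to [D] is [c] times [q] as soon as
    the two agree on boxes. In the uses below [c] carries the probability of [N = n] and powers of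
    [s]. *)
Lemma integral_tuple_law d d' (Om : measurableType d') (T : measurableType d)
    (R : realType) n (nu : {measure set Om -> \bar R}) (Y : Om -> n.-tuple T)
    (D : set Om) (c : {nonneg R}) (q : {measure set (n.-tuple T) -> \bar R})
    (H : set (set T)) (phi : n.-tuple T -> \bar R) :
  measurable_fun setT Y -> measurable D -> (nu D < +oo)%E ->
  measurable = <<s H >> -> H setT -> setI_closed H ->
  (forall B : 'I_n -> set T, (forall i, H (B i)) ->
    nu (D `&` Y @^-1` box B) = (c%:num%:E * q (box B))%E) ->
  measurable_fun setT phi -> (forall z, 0 <= phi z)%E ->
  (\int[nu]_(o in D) phi (Y o) = c%:num%:E * \int[q]_z phi z)%E.
Proof.
move=> mY mD Doo mH HT HI boxE mphi phi0.
pose m1 : {measure set (n.-tuple T) -> \bar R} :=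
  measure_function_pushforward__canonical__measure_function_Measure (mrestr nu mD) mY.
pose m2 : {measure set (n.-tuple T) -> \bar R} := mscale c q.
have m12 A : measurable A -> m1 A = m2 A.
  apply: (tuple_measure_unique mH HT HI).
    by rewrite /m1 /= /pushforward /mrestr preimage_setT setTI.
  by move=> B HB; rewrite /m1 /m2 /= /pushforward /mrestr setIC boxE.
transitivity (\int[m1]_z phi z)%E.
  rewrite (ge0_integral_pushforward mY)//=.
  by rewrite preimage_setT integral_mrestr.
rewrite -ge0_integral_mscale//; apply: eq_measure_integral => A mA _.
exact: m12.
Qed.

Definition ext_sets T n (B : 'I_n -> set T) (i : nat) : set T :=
  if insub i is Some j then B j else setT.

Lemma ext_setsE T n (B : 'I_n -> set T) (i : 'I_n) : ext_sets B i = B i.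
Proof. by rewrite /ext_sets valK. Qed.

Lemma measurable_ext_sets d (T : measurableType d) n (B : 'I_n -> set T) i :
  (forall j, measurable (B j)) -> measurable (ext_sets B i).
Proof. by move=> mB; rewrite /ext_sets; case: insub. Qed.

Definition rectangles d1 d2 (T1 : measurableType d1) (T2 : measurableType d2) :
    set (set (T1 * T2)) :=
  [set A `*` B | A in measurable & B in measurable].

(** * Joint laws of the sample, its size and the extra marks *)

Section marked_sample_laws.
Context (R : realType) (dX dM dO : measure_display).
Context (X : measurableType dX) (M : measurableType dM) (Omega : measurableType dO).
Variables (mu : probability X R) (m : probability M R) (P : probability Omega R).
Variables (XT : nat -> {mfun Omega >-> (X * M)%type}) (N : {mfun Omega >-> nat}).
Variables (tau : nat -> {mfun Omega >-> M}).
Hypothesis XT_distr : forall i A, measurable A ->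
    distribution P (XT i) A = (mu \x m)%E A.
Hypothesis tau_distr : forall j A, measurable A -> distribution P (tau j) A = m A.
Hypothesis indep : mutually_independent P (sources XT N tau).
Local Open Scope ereal_scope.
Local Notation XM := (X * M)%type.

Definition sample_event (n k : nat) (D : set nat) (B : nat -> set XM)
    (C : nat -> set M) : set Omega :=
  [set o | [/\ D (N o), forall i, (i < n)%N -> B i (XT i o) &
               forall j, (j < k)%N -> C j (tau j o)]].

Lemma sample_eventE n k D B C :
  (forall i, measurable (B i)) -> (forall j, measurable (C j)) ->
  P (sample_event n k D B C) = P (N @^-1` D) *
    ((\prod_(i < n) (mu \x m) (B i)) * \prod_(j < k) m (C j)).
Proof.
move=> mB mC.
pose J : seq (nat + unit + nat) := inl (inr tt) ::
  [seq inl (inl i) | i <- iota 0 n] ++ [seq inr j | j <- iota 0 k].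
pose E (s : nat + unit + nat) := match s with
  | inl (inl i) => XT i @^-1` B i
  | inl (inr _) => N @^-1` D
  | inr j => tau j @^-1` C j end.
have -> : sample_event n k D B C = \bigcap_(s in [set` J]) E s.
  apply/seteqP; split => [omg [ND XTB tauC] s|omg JE].
    rewrite /= inE mem_cat => /orP[/eqP ->//|/orP[]/mapP[i]].
      by rewrite mem_iota add0n => /andP[_ ?] -> /=; exact: XTB.
    by rewrite mem_iota add0n => /andP[_ ?] -> /=; exact: tauC.
  split; [|move=> i ni|move=> j kj].
  - by apply: (JE (inl (inr tt))); rewrite /= mem_head.
  - apply: (JE (inl (inl i))); rewrite /= inE mem_cat map_f ?orbT//.
    by rewrite mem_iota.
  - apply: (JE (inr j)); rewrite /= inE mem_cat [in X in _ || X]orbC map_f ?orbT//.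
    by rewrite mem_iota.
rewrite indep; last 2 first.
- rewrite /J /= mem_cat negb_or cat_uniq.
  apply/andP; split; first by apply/andP; split; apply/mapP => -[].
  apply/and3P; split.
  + by rewrite map_inj_uniq ?iota_uniq// => i j [].
  + by apply/hasPn => s /mapP[j _ ->]; apply/mapP => -[].
  + by rewrite map_inj_uniq ?iota_uniq// => i j [].
- move=> s; rewrite inE mem_cat => /orP[/eqP ->|/orP[]/mapP[i _ ->]] /=.
  + by exists D; rewrite ?setTI.
  + by exists (B i); rewrite ?setTI.
  + by exists (C i); rewrite ?setTI.
rewrite /J big_cons big_cat /= !big_map; congr (_ * (_ * _)).
- rewrite -[X in iota 0 X](subn0 n) -/(index_iota 0 n) big_mkord; apply: eq_bigr => i _.
  exact: XT_distr.
- rewrite -[X in iota 0 X](subn0 k) -/(index_iota 0 k) big_mkord; apply: eq_bigr => i _.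
  exact: tau_distr.
Qed.

Lemma measurable_N (D : set nat) : measurable (N @^-1` D).
Proof. by rewrite -[X in measurable X]setTI; exact: measurable_funP. Qed.

Lemma measurable_sample_event n k D B C :
  (forall i, measurable (B i)) -> (forall j, measurable (C j)) ->
  measurable (sample_event n k D B C).
Proof.
move=> mB mC; rewrite (_ : sample_event n k D B C = N @^-1` D `&`
    (\bigcap_(i in [set i | (i < n)%N]) XT i @^-1` B i `&`
     \bigcap_(j in [set j | (j < k)%N]) tau j @^-1` C j)).
  apply: measurableI; first exact: measurable_N.
  by apply: measurableI; apply: bigcap_measurableType => i _;
    rewrite -[X in measurable X]setTI; exact: measurable_funP.
by apply/seteqP; split => [w [Nw wB wC]|w [Nw [wB wC]]].
Qed.

Definition sample n (w : Omega) : n.-tuple XM := [tuple XT i w | i < n].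

Lemma measurable_sample n : measurable_fun setT (sample n).
Proof.
apply/measurable_fun_tnthP => i.
rewrite (_ : _ \o _ = XT i)//; apply/funext => w /=.
by rewrite tnth_mktuple.
Qed.

Local Notation Npr n := (NngNum (fine_ge0 (measure_ge0 P (N @^-1` [set n])))).

Definition point_law : {finite_measure set XM -> \bar R} :=
  product_subprobability (mu : subprobability X R, m : subprobability M R).
Local Notation muM := point_law.

Lemma integral_sample n (phi : n.-tuple XM -> \bar R) :
  measurable_fun setT phi -> (forall z, 0 <= phi z) ->
  \int[P]_(w in N @^-1` [set n]) phi (sample n w) =
    P (N @^-1` [set n]) * \int[tuple_power muM n]_z phi z.
Proof.
move=> mphi phi0.
rewrite (@integral_tuple_law _ _ _ _ _ _ P (sample n) _ (Npr n)
   (tuple_power muM n) measurable) //.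
- by rewrite /= fineK// fin_num_measure//; exact: measurable_N.
- exact: measurable_sample.
- exact: measurable_N.
- by rewrite (le_lt_trans (probability_le1 _ _))// ?ltry//; exact: measurable_N.
- by rewrite sigma_algebra_id//; exact: sigma_algebra_measurable.
- by move=> A B; exact: measurableI.
move=> B mB; rewrite /= fineK; last first.
  by rewrite fin_num_measure//; exact: measurable_N.
rewrite [X in _ * X](tuple_power_box muM mB).
have mE i : measurable (ext_sets B i) by exact: measurable_ext_sets.
have := @sample_eventE n 0 [set n] (ext_sets B) (fun=> setT) mE
  (fun=> measurableT).
rewrite big_ord0 mule1 => sE.
transitivity (P (sample_event n 0 [set n] (ext_sets B) (fun=> setT))).
  congr (P _); apply/seteqP; split => [w [Nw wB]|w [Nw wB _]].
    split=> // i ni; have := wB (Ordinal ni).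
    by rewrite tnth_mktuple -ext_setsE.
  split=> // i; rewrite tnth_mktuple -ext_setsE; exact: wB.
by rewrite sE; congr (_ * _); apply: eq_bigr => i _; rewrite ext_setsE.
Qed.

Definition mark (a : nat + nat) (w : Omega) : M :=
  match a with inl i => (XT i w).2 | inr j => tau j w end.

Lemma measurable_mark a : measurable_fun setT (mark a).
Proof.
case: a => [i|j] /=; last exact: measurable_funP.
by apply: (measurableT_comp (f := snd)) => //; exact: measurable_funP.
Qed.

Lemma mark_pair_law a b (A : set (M * M)) : a != b -> measurable A ->
  P [set w | A (mark a w, mark b w)] = (m \x m) A.
Proof.
move=> ab mA.
have mab : measurable_fun setT (fun w => (mark a w, mark b w)).
  by apply: measurable_fun_pair; exact: measurable_mark.
pose m' : {measure set (M * M) -> \bar R} :=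
  measure_function_pushforward__canonical__measure_function_Measure P mab.
rewrite (product_measure_unique (m' := m'))// => A1 A2 mA1 mA2.
pose src (c : nat + nat) : nat + unit + nat :=
  match c with inl i => inl (inl i) | inr j => inr j end.
pose E (B C : set M) (t : nat + unit + nat) :=
  if t == src a then mark a @^-1` B else mark b @^-1` C.
have sab : src b != src a.
  by apply: contra ab; case: (a) (b) => [i|i] [j|j] //= /eqP[->].
have markE (c : nat + nat) B : measurable B -> P (mark c @^-1` B) = m B.
  move=> mB; case: c => [i|j] /=; last exact: tau_distr.
  rewrite -[RHS]mul1e -(probability_setT mu) -product_measure1E//.
  rewrite -(XT_distr i); last exact: measurableX.
  by rewrite /distribution /pushforward; congr (P _); apply/seteqP; split => [w|w []].
transitivity (P (\bigcap_(t in [set` [:: src a; src b]]) E A1 A2 t)).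
  congr (P _); apply/seteqP; split => [w [/= w1 w2] t|w wE].
    by rewrite /= !inE /E => /orP[]/eqP ->; rewrite ?eqxx ?(negbTE sab).
  split; first by have := wE (src a); rewrite /E eqxx; apply; rewrite /= mem_head.
  have := wE (src b); rewrite /E (negbTE sab); apply.
  by rewrite /= !inE eqxx orbT.
rewrite indep.
- rewrite big_cons big_seq1 /E eqxx (negbTE sab) /=.
  by rewrite !markE.
- by rewrite /= inE eq_sym sab.
- move=> t; rewrite !inE => /orP[]/eqP -> /=; rewrite /E ?eqxx ?(negbTE sab).
    case: (a) => [i|j] /=; last by exists A1; rewrite ?setTI.
    exists (setT `*` A1); first exact: measurableX.
    by rewrite setTI; apply/seteqP; split => [w []|w].
  case: (b) => [i|j] /=; last by exists A2; rewrite ?setTI.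
  exists (setT `*` A2); first exact: measurableX.
  by rewrite setTI; apply/seteqP; split => [w []|w].
Qed.

Section distinct_marks.
Variable A : set (M * M).
Hypotheses (mA : measurable A) (A0 : (m \x m) A = 0) (A_diag : forall t, A (t, t)).

(** Pairs of marks must avoid [A] and not merely the diagonal, which need not be a measurable
    set. *)
Definition distinct_marks : set Omega :=
  [set w | forall a b, a != b -> ~ A (mark a w, mark b w)].

Let bad (n : nat) : set Omega :=
  if choice.unpickle n is Some (a, b) then
    if a != b then [set w | A (mark a w, mark b w)] else set0
  else set0.

Let measurable_bad n : measurable (bad n).
Proof.
rewrite /bad; case: choice.unpickle => [[a b]|//]; case: ifP => // ab.
rewrite -[X in measurable X]setTI.
have mab : measurable_fun setT (fun w => (mark a w, mark b w)).
  by apply: measurable_fun_pair; exact: measurable_mark.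
exact: mab.
Qed.

Let distinct_marksC : ~` distinct_marks = \bigcup_n bad n.
Proof.
apply/seteqP; split => [w|w [n _]].
  rewrite /distinct_marks /=.
  move=> /existsNP[a /existsNP[b /not_implyP[ab /contrapT Aab]]].
  by exists (choice.pickle (a, b)) => //; rewrite /bad choice.pickleK ab.
rewrite /bad; case: choice.unpickle => [[a b]|//]; case: ifP => // ab /= Aab.
by move=> /(_ _ _ ab); exact.
Qed.

Lemma measurable_distinct_marks : measurable distinct_marks.
Proof.
rewrite -[distinct_marks]setCK distinct_marksC; apply: measurableC.
exact: bigcupT_measurable.
Qed.

Lemma distinct_marksC0 : P (~` distinct_marks) = 0.
Proof.
have : P.-negligible (\bigcup_n bad n).
  apply: negligible_bigcup => n; apply/negligibleP => //.
  rewrite /bad; case: choice.unpickle => [[a b]|]; last by rewrite measure0.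
  by case: ifP => [ab|_]; [exact: etrans (mark_pair_law ab mA) A0|rewrite measure0].
rewrite distinct_marksC => /negligibleP; apply.
exact: bigcupT_measurable.
Qed.

Definition distinct_tuples n : set (n.-tuple XM) :=
  [set z | forall i j, i != j -> ~ A ((tnth z i).2, (tnth z j).2)].

Lemma measurable_distinct_tuples n : measurable (@distinct_tuples n).
Proof.
rewrite (_ : @distinct_tuples n = \bigcap_(p in [set p : 'I_n * 'I_n | p.1 != p.2])
    ~` [set z | A ((tnth z p.1).2, (tnth z p.2).2)]).
  apply: fin_bigcap_measurable => // p _; apply: measurableC.
  rewrite -[X in measurable X]setTI.
  have mp : measurable_fun setT (fun z : n.-tuple XM => ((tnth z p.1).2, (tnth z p.2).2)).
    by apply: measurable_fun_pair; apply: (measurableT_comp (f := snd)) => //;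
      exact: measurable_tnth.
  exact: mp.
apply/seteqP; split => [z zd [i j] /= ij|z zd i j ij]; first exact: zd.
exact: (zd (i, j)).
Qed.

Lemma distinct_tuples_inj n z : @distinct_tuples n z -> injective (tnth z).
Proof.
move=> zd i j zij; apply/eqP/negPn/negP => /zd; apply.
by rewrite zij; exact: A_diag.
Qed.

Lemma distinct_sample n w : distinct_marks w -> distinct_tuples (sample n w).
Proof.
move=> wd i j ij; rewrite !tnth_mktuple; apply: (wd (inl (val i)) (inl (val j))).
by apply: contra ij => /eqP[/val_inj ->].
Qed.

(** The [k] given locations with their fresh marks come first and the sample follows, so that both
    [pts x] and [eta] are subconfigurations of one tuple. *)
Definition tagged_sample k n (x : k.-tuple X) (w : Omega) : (k + n).-tuple XM :=
  [tuple match fintype.split i with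
         | inl a => (tnth x a, tau a w) | inr b => XT b w end | i < k + n].

Lemma tagged_sample_lshift k n (x : k.-tuple X) w (a : 'I_k) :
  tnth (@tagged_sample k n x w) (lshift n a) = (tnth x a, tau a w).
Proof.
by rewrite tnth_mktuple; have /= -> := fintype.unsplitK (inl a : ('I_k + 'I_n)%type).
Qed.

Lemma tagged_sample_rshift k n (x : k.-tuple X) w (b : 'I_n) :
  tnth (@tagged_sample k n x w) (rshift k b) = XT b w.
Proof.
by rewrite tnth_mktuple; have /= -> := fintype.unsplitK (inr b : ('I_k + 'I_n)%type).
Qed.

Lemma distinct_tagged_sample k n x w :
  distinct_marks w -> distinct_tuples (@tagged_sample k n x w).
Proof.
move=> wd i j ij; rewrite !tnth_mktuple.
pose mk (c : 'I_k + 'I_n) : nat + nat :=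
  match c with inl a => inr (val a) | inr b => inl (val b) end.
pose pt (c : 'I_k + 'I_n) : XM :=
  match c with inl a => (tnth x a, tau a w) | inr b => XT b w end.
have ptE c : (pt c).2 = mark (mk c) w by case: c.
rewrite -/(pt (fintype.split i)) -/(pt (fintype.split j)) !ptE.
apply: wd; apply: contra ij => /eqP mkE.
rewrite -(fintype.splitK i) -(fintype.splitK j); apply/eqP; congr unsplit.
by case: (fintype.split i) (fintype.split j) mkE => [a|a] [b|b] //= [/val_inj ->].
Qed.

End distinct_marks.

Lemma measurable_tagged_sample k n :
  measurable_fun setT (fun q : k.-tuple X * Omega => tagged_sample n q.1 q.2).
Proof.
apply/measurable_fun_tnthP => i; rewrite /comp.
under eq_fun do rewrite tnth_mktuple.
case: (fintype.split i) => [a|b].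
  apply: measurable_fun_pair.
    apply: (measurableT_comp (f := fun t => tnth t a)) => //.
    exact: measurable_tnth.
  apply: (measurableT_comp (f := tau a)) => //.
by apply: (measurableT_comp (f := XT b)).
Qed.

Section tagged_sample_integral.
Variables (s : {nonneg R}) (k n : nat) (phi : (k + n).-tuple XM -> \bar R).
Hypotheses (mphi : measurable_fun setT phi) (phi0 : forall z, 0 <= phi z).

Definition intensity : {finite_measure set X -> \bar R} := mscale s mu.

Let D : set (k.-tuple X * Omega) := setT `*` N @^-1` [set n].

Let mD : measurable D.
Proof. by apply: measurableX => //; exact: measurable_N. Qed.

Let phiD : k.-tuple X * Omega -> \bar R :=
  (fun q => phi (tagged_sample n q.1 q.2)) \_ D.

Let mphiD : measurable_fun setT phiD.
Proof.
apply/(measurable_restrict _ mD measurableT); rewrite setTI.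
apply: measurable_funTS; apply: (measurableT_comp mphi).
exact: measurable_tagged_sample.
Qed.

Let phiD0 q : 0 <= phiD q.
Proof. by rewrite /phiD patchE; case: ifP. Qed.

Let phiDE x : fubini_F P phiD x =
  \int[P]_(w in N @^-1` [set n]) phi (tagged_sample n x w).
Proof.
rewrite /fubini_F [RHS]integral_mkcond; apply: eq_integral => w _.
rewrite /phiD !patchE; congr (if _ then _ else _).
by apply/idP/idP => /set_mem Dw; apply/mem_set; [case: Dw|split].
Qed.

Lemma measurable_integral_tagged_sample : measurable_fun setT (fun x : k.-tuple X =>
  \int[P]_(w in N @^-1` [set n]) phi (tagged_sample n x w)).
Proof.
under eq_fun do rewrite -phiDE.
exact: measurable_fun_fubini_tonelli_F.
Qed.

(** On a rectangle the location, integrated against [s * mu], and the independent mark factor into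
    [s] times [mu \x m]. Hence tagged points become indistinguishable from sample points, at the
    price of [s^k]. *)
Lemma tagged_sample_box (B : 'I_(k + n) -> set XM) :
  (forall i, rectangles (B i)) ->
  (tuple_power intensity k \x P)
    (D `&` (fun q => tagged_sample n q.1 q.2) @^-1` box B) =
  ((s%:num ^+ k)%:E * P (N @^-1` [set n])) * tuple_power muM (k + n) (box B).
Proof.
move=> HB.
have /choice[q qP] : forall i, exists q : set X * set M,
    [/\ measurable q.1, measurable q.2 & q.1 `*` q.2 = B i].
  by move=> i; have [A1 mA1 [A2 mA2 BE]] := HB i; exists (A1, A2).
have mB i : measurable (B i).
  by have [m1 m2 <-] := qP i; exact: measurableX.
pose BT (b : 'I_n) := B (rshift k b).
pose BX (a : 'I_k) := (q (lshift n a)).1.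
pose BM (a : 'I_k) := (q (lshift n a)).2.
have mBX a : measurable (BX a) by have [] := qP (lshift n a).
have mBM a : measurable (BM a) by have [] := qP (lshift n a).
have mBT b : measurable (BT b) by exact: mB.
have -> : D `&` (fun q => tagged_sample n q.1 q.2) @^-1` box B =
    box BX `*` sample_event n k [set n] (ext_sets BT) (ext_sets BM).
  apply/seteqP; split => [[x w] [[_ Nw] xwB]|[x w] [/= xB [Nw wT wM]]].
    have lB a : BX a (tnth x a) /\ BM a (tau a w).
      by have := xwB (lshift n a); rewrite /= tagged_sample_lshift; have [_ _ <-] := qP (lshift n a).
    split=> /=; first by move=> a; have [] := lB a.
    split=> // [i ni|j jk].
      have := xwB (rshift k (Ordinal ni)); rewrite /= tagged_sample_rshift.
      by rewrite -/(BT (Ordinal ni)) -(ext_setsE BT).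
    by have [_] := lB (Ordinal jk); rewrite -(ext_setsE BM).
  split=> // i /=; rewrite -(fintype.splitK i); case: (fintype.split i) => [a|b] /=.
    rewrite tagged_sample_lshift; have [_ _ <-] := qP (lshift n a); split; first exact: xB.
    by have := wM a (ltn_ord a); rewrite ext_setsE.
  by rewrite tagged_sample_rshift; have := wT b (ltn_ord b); rewrite ext_setsE.
rewrite product_measure1E; last 2 first.
- exact: measurable_box.
- by apply: measurable_sample_event => i; exact: measurable_ext_sets.
rewrite [X in _ * X = _]sample_eventE; last 2 first.
- by move=> i; exact: measurable_ext_sets.
- by move=> i; exact: measurable_ext_sets.
rewrite [X in X * _ = _](tuple_power_box intensity mBX).
rewrite [X in _ = _ * X](tuple_power_box muM mB) big_split_ord /=.
have -> : \prod_(i < k) muM (B (lshift n i)) =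
    (\prod_(i < k) mu (BX i)) * \prod_(i < k) m (BM i).
  rewrite -big_split /=; apply: eq_bigr => a _.
  by have [m1 m2 <-] := qP (lshift n a); exact: product_measure1E.
have -> : \prod_(i < k) mscale s mu (BX i) =
    (s%:num ^+ k)%:E * \prod_(i < k) mu (BX i).
  rewrite /mscale big_split /=; congr (_ * _).
  rewrite prodEFin prodr_const card_ord.
  by [].
rewrite (eq_bigr (fun i : 'I_n => (mu \x m) (B (rshift k i)))); last first.
  by move=> i _; rewrite ext_setsE.
rewrite [X in _ * (_ * (_ * X))](eq_bigr (fun i => m (BM i))); last first.
  by move=> i _; rewrite ext_setsE.
rewrite -!muleA; congr (_ * _).
by rewrite [LHS]muleCA; congr (_ * (_ * _)); exact: muleC.
Qed.

Lemma integral_tagged_sample :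
  \int[tuple_power intensity k]_x
    \int[P]_(w in N @^-1` [set n]) phi (tagged_sample n x w) =
  ((s%:num ^+ k)%:E * P (N @^-1` [set n])) * \int[tuple_power muM (k + n)]_z phi z.
Proof.
have finN : P (N @^-1` [set n]) \is a fin_num.
  by rewrite fin_num_measure//; exact: measurable_N.
under eq_integral do rewrite -phiDE.
rewrite -fubini_tonelli1// /phiD -integral_mkcond.
have c0 : (0 <= s%:num ^+ k * fine (P (N @^-1` [set n])))%R.
  by rewrite mulr_ge0// ?exprn_ge0 ?fine_ge0.
rewrite (@integral_tuple_law _ _ _ _ _ _ (tuple_power intensity k \x P)
  (fun q => tagged_sample n q.1 q.2) D (NngNum c0)
  (tuple_power muM (k + n)) (@rectangles _ _ X M))//=.
- by rewrite EFinM fineK.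
- exact: measurable_tagged_sample.
- rewrite product_measure1E//; last exact: measurable_N.
  by rewrite ltey_eq fin_numM// fin_num_measure.
- exact: measurable_prod_measurableType.
- by exists setT => //; exists setT => //; rewrite setXTT.
- move=> _ _ [A1 mA1 [A2 mA2 <-]] [B1 mB1 [B2 mB2 <-]].
  exists (A1 `&` B1); first exact: measurableI.
  by exists (A2 `&` B2); [exact: measurableI|rewrite setXI].
- by move=> B HB; rewrite EFinM fineK//; exact: tagged_sample_box.
Qed.

End tagged_sample_integral.

End marked_sample_laws.

(** * The Mecke equation *)

Section permutations_of_tuples.

(** Listing each set before its complement and matching the two lists position by position gives the
    permutation. *)
Lemma exists_perm_imset (I : finType) (J K : {set I}) : #|J| = #|K| ->
  exists sg : {perm I}, (forall i, (sg i \in K) = (i \in J)).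
Proof.
move=> JK.
pose s1 (L : {set I}) := enum L ++ enum (~: L).
have us L : uniq (s1 L).
  rewrite cat_uniq !enum_uniq andbT /=; apply/hasPn => i.
  by rewrite !mem_enum inE.
have ms L i : i \in s1 L by rewrite mem_cat !mem_enum inE orbN.
have ss L : size (s1 L) = #|I|.
  by rewrite -(card_uniqP (us L)); apply: eq_card => i; rewrite ms.
pose sg i := nth i (s1 K) (index i (s1 J)).
have idx i : (index i (s1 J) < size (s1 K))%N by rewrite ss -(ss J) index_mem ms.
have sg_inj : injective sg.
  move=> i j; rewrite /sg (set_nth_default j)// => /eqP.
  rewrite nth_uniq// => /eqP ij.
  by rewrite -(nth_index i (ms J i)) ij nth_index// ms.
have sgK i : i \in J -> sg i \in K.
  move=> iJ; have iJ' : i \in enum J by rewrite mem_enum.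
  have ilt : (index i (enum J) < size (enum K))%N.
    by rewrite -cardE -JK cardE index_mem.
  by rewrite /sg index_cat iJ' nth_cat ilt -mem_enum mem_nth.
exists (perm sg_inj) => i; rewrite permE; apply/idP/idP => [iK|]; last exact: sgK.
have sgJ : sg @: J = K.
  apply/eqP; rewrite eqEcard card_imset// JK leqnn andbT.
  by apply/fintype.subsetP => _ /imsetP[j jJ ->]; exact: sgK.
by move: iK; rewrite -sgJ => /imsetP[j jJ /sg_inj ->].
Qed.

Context d (T : measurableType d) (R : realType) (q : {finite_measure set T -> \bar R}).
Variable n : nat.
Local Open Scope ereal_scope.

Definition permute (sg : {perm 'I_n}) (z : n.-tuple T) : n.-tuple T :=
  [tuple tnth z (sg i) | i < n].

Lemma measurable_permute sg : measurable_fun setT (permute sg).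
Proof.
apply/measurable_fun_tnthP => i.
rewrite (_ : _ \o _ = (fun z => tnth z (sg i))); first exact: measurable_tnth.
by apply/funext => z /=; rewrite tnth_mktuple.
Qed.

Lemma integral_permute sg (phi : n.-tuple T -> \bar R) :
  measurable_fun setT phi -> (forall z, 0 <= phi z) ->
  \int[tuple_power q n]_z phi (permute sg z) = \int[tuple_power q n]_z phi z.
Proof.
move=> mphi phi0.
rewrite (@integral_tuple_law _ _ _ _ _ _ (tuple_power q n) (permute sg) setT
  (NngNum (@ler01 R)) (tuple_power q n) measurable)//= ?mul1e//.
- exact: measurable_permute.
- by rewrite ltey_eq fin_num_measure.
- by rewrite sigma_algebra_id//; exact: sigma_algebra_measurable.
- by move=> A B; exact: measurableI.
move=> B mB; rewrite setTI mul1e.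
rewrite (_ : permute sg @^-1` box B = box (fun i => B ((sg^-1)%g i))); last first.
  apply/seteqP; split => z zB i /=.
    by have := zB ((sg^-1)%g i); rewrite tnth_mktuple permKV.
  by rewrite tnth_mktuple; have := zB (sg i); rewrite permK.
rewrite [LHS](tuple_power_box q)// [RHS](tuple_power_box q)//.
by rewrite [RHS](reindex_inj (perm_inj (s := (sg^-1)%g))).
Qed.

End permutations_of_tuples.

Lemma subconfig_permute d (T : measurableType d) n (z : n.-tuple T) (sg : {perm 'I_n})
    (J K : {set 'I_n}) : (forall i, (sg i \in K) = (i \in J)) ->
  subconfig J (permute sg z) = subconfig K z.
Proof.
move=> sgJ; apply/fsetP => x; apply/subconfigP/subconfigP => -[i iJ ->].
  by exists (sg i); rewrite ?sgJ// tnth_mktuple.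
exists ((sg^-1)%g i); last by rewrite tnth_mktuple permKV.
by rewrite -sgJ permKV.
Qed.

Section mecke.
Context (R : realType) (dX dM dO : measure_display).
Context (X : measurableType dX) (M : measurableType dM) (Omega : measurableType dO).
Variables (mu : probability X R) (m : probability M R) (P : probability Omega R).
Variables (XT : nat -> {mfun Omega >-> (X * M)%type}) (N : {mfun Omega >-> nat}).
Variables (tau : nat -> {mfun Omega >-> M}).
Add Field Rfield : (@F_field_theory R)
  (morphism (@F_morph R), constants [field_cst], power_tac (@F_power R) [nat_cst]).
Variable s : R.
Hypothesis s_gt0 : 0 < s.
Hypothesis XT_distr : forall i A, measurable A ->
    distribution P (XT i) A = (mu \x m)%E A.
Hypothesis N_distr : forall A, distribution P N A = poisson_prob s 0 A.
Hypothesis tau_distr : forall j A, measurable A -> distribution P (tau j) A = m A.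
Hypothesis indep : mutually_independent P (sources XT N tau).
Variable k : nat.
Variable f : config (X * M)%type -> config (X * M)%type -> bool.
Hypothesis f_meas : measurable_fun
    ([set psi : config (X * M)%type | #|` psi| = k] `*` setT)
    (fun q => f q.1 q.2).
Variable A : set (M * M).
Hypotheses (mA : measurable A) (A0 : (m \x m)%E A = 0%E).
Hypothesis A_diag : forall t, A (t, t).
Local Open Scope ereal_scope.
Local Notation XM := (X * M)%type.
Local Notation muM := (point_law mu m).
Local Notation DT n := (@distinct_tuples dX dM X M A n).

Local Notation F := (subset_count k f).
Local Notation eta := (poisson_process XT N).
Local Notation pts := (marked_points tau).

Definition pattern n (J : {set 'I_n}) (z : n.-tuple XM) : bool :=
  f (subconfig J z) (subconfig (~: J) z).

Section pattern_integrals.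
Variable G : nat -> R.
Hypothesis G_ge0 : forall i, (0 <= G i)%R.

(** The value is 0 off the distinct tuples, where maps into configurations need not be
    measurable. *)
Definition pattern_term n (J : {set 'I_n}) (z : n.-tuple XM) : \bar R :=
  ((fun z => ((pattern J z)%:R * G (F (subconfig [set: 'I_n]%SET z)))%:E) \_ (DT n)) z.

Lemma pattern_term_ge0 n (J : {set 'I_n}) z : 0 <= pattern_term J z.
Proof.
by rewrite /pattern_term patchE; case: ifP => // _; rewrite lee_fin mulr_ge0.
Qed.

Lemma measurable_pattern_term n (J : {set 'I_n}) : #|J| = k ->
  measurable_fun setT (pattern_term J).
Proof.
move=> Jk; have mD := @measurable_distinct_tuples _ _ X M _ mA n.
have Dinj := @distinct_tuples_inj _ _ X M _ A_diag n.
apply/(measurable_restrict _ mD measurableT); rewrite setTI.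
apply/measurable_EFinP; apply: measurable_funM.
  apply: (measurableT_comp (f := fun b : bool => (b%:R : R))) => //.
  exact: (measurable_subset_pattern mD Dinj f_meas Jk).
apply: (measurableT_comp (f := G)) => //.
exact: (measurable_subset_count mD Dinj f_meas).
Qed.

Lemma distinct_tuples_permute n (sg : {perm 'I_n}) z : DT n (permute sg z) <-> DT n z.
Proof.
split => zd i j ij; last by rewrite !tnth_mktuple; apply: zd; rewrite (inj_eq perm_inj).
have := zd ((sg^-1)%g i) ((sg^-1)%g j); rewrite !tnth_mktuple !permKV; apply.
by rewrite (inj_eq perm_inj).
Qed.

(** The product measure is exchangeable, and a permutation carrying one index set to the other
    leaves the whole configuration, hence the factor [G], unchanged. *)
Lemma integral_pattern_term n (J K : {set 'I_n}) : #|J| = k -> #|K| = k ->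
  \int[tuple_power muM n]_z pattern_term J z =
  \int[tuple_power muM n]_z pattern_term K z.
Proof.
move=> Jk Kk; have [sg sgJ] := exists_perm_imset (etrans Kk (esym Jk)).
rewrite -[RHS](integral_permute muM sg (measurable_pattern_term Kk)); last first.
  by move=> z; exact: pattern_term_ge0.
apply: eq_integral => z _; rewrite /pattern_term !patchE.
have -> : (permute sg z \in DT n) = (z \in DT n).
  by apply/idP/idP => /set_mem /distinct_tuples_permute /mem_set.
case: ifP => // _; rewrite /pattern.
have sgC i : (sg i \in ~: J) = (i \in ~: K) by rewrite !inE sgJ.
have sgT i : (sg i \in [set: 'I_n]%SET) = (i \in [set: 'I_n]%SET) by rewrite !inE.
by rewrite (subconfig_permute z sgJ) (subconfig_permute z sgC) (subconfig_permute z sgT).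
Qed.

Local Notation good := (distinct_marks XT tau A).

Lemma poisson_process_sample n w : N w = n ->
  eta w = subconfig [set: 'I_n]%SET (sample XT n w).
Proof.
move=> <-; apply/fsetP => x; apply/imfsetP/subconfigP => -[i].
  rewrite /= mem_iota add0n => /andP[_ iN] ->.
  by exists (Ordinal iN); rewrite ?inE// tnth_mktuple.
move=> _ ->; exists (val i); rewrite ?tnth_mktuple//= mem_iota add0n /=.
exact: ltn_ord.
Qed.

Lemma W_sum w n : good w -> N w = n ->
  ((F (eta w))%:R * G (F (eta w)))%:E =
  \sum_(J : {set 'I_n} | #|J| == k) pattern_term J (sample XT n w).
Proof.
move=> gw Nw; rewrite (poisson_process_sample Nw).
have zd := distinct_sample (n := n) gw.
under eq_bigr do rewrite /pattern_term patchE (mem_set zd).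
rewrite sumEFin -mulr_suml; congr (_ * _)%:E.
rewrite (subset_countE _ _ (distinct_tuples_inj A_diag zd)) natr_sum.
exact: eq_bigr.
Qed.

Definition first_points n : {set 'I_(k + n)} := [set lshift n a | a : 'I_k]%SET.

Lemma card_first_points n : #|first_points n| = k.
Proof. by rewrite card_imset ?card_ord//; exact: lshift_inj. Qed.

Lemma mem_first_points n i : (i \in first_points n) =
  if fintype.split i is inl _ then true else false.
Proof.
apply/imsetP/idP => [[a _ ->]|].
  by have /= -> := fintype.unsplitK (inl a : ('I_k + 'I_n)%type).
rewrite -{2}(fintype.splitK i); case: (fintype.split i) => // a _ /=.
by exists a.
Qed.

Lemma marked_points_tagged n x w :
  pts x w = subconfig (first_points n) (tagged_sample XT tau n x w).
Proof.
apply/fsetP => y; apply/imfsetP/subconfigP => -[i].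
  move=> _ ->; exists (lshift n i); last by rewrite tagged_sample_lshift.
  by apply/imsetP; exists i.
by move=> /imsetP[a _ ->] ->; exists a; rewrite ?tagged_sample_lshift.
Qed.

Lemma poisson_process_tagged n x w : N w = n ->
  eta w = subconfig (~: first_points n) (tagged_sample XT tau n x w).
Proof.
move=> Nw; rewrite (poisson_process_sample Nw).
apply/fsetP => y; apply/subconfigP/subconfigP => -[i].
  move=> _ ->; exists (rshift k i); last by rewrite tagged_sample_rshift tnth_mktuple.
  rewrite inE mem_first_points.
  by have /= -> := fintype.unsplitK (inr i : ('I_k + 'I_n)%type).
rewrite inE mem_first_points -(fintype.splitK i).
case: (fintype.split i) => [a|b] /=.
  by have /= -> := fintype.unsplitK (inl a : ('I_k + 'I_n)%type).
by move=> _ ->; exists b; rewrite ?inE// tagged_sample_rshift tnth_mktuple.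
Qed.

Lemma tagged_term x w n : good w -> N w = n ->
  ((f (pts x w) (eta w))%:R * G (F (pts x w `|` eta w)%fset))%:E =
  pattern_term (first_points n) (tagged_sample XT tau n x w).
Proof.
move=> gw Nw; rewrite (poisson_process_tagged x Nw) (marked_points_tagged n).
have zd := distinct_tagged_sample (n := n) (x := x) gw.
by rewrite /pattern_term patchE (mem_set zd) /pattern -subconfigU.
Qed.

Definition pattern_mass n : \bar R :=
  \int[tuple_power muM (k + n)]_z pattern_term (first_points n) z.

Lemma pattern_mass_ge0 n : 0 <= pattern_mass n.
Proof. by apply: integral_ge0 => z _; exact: pattern_term_ge0. Qed.

Lemma N_pmf n : P (N @^-1` [set n]) = (poisson_pmf s n)%:E.
Proof.
have := N_distr [set n]; rewrite /distribution /pushforward => ->.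
rewrite /poisson_prob s_gt0 esum_set1//.
by rewrite lee_fin poisson_pmf_ge0.
Qed.

Lemma bigcup_N : \bigcup_n N @^-1` [set n] = setT.
Proof. by apply/seteqP; split => // w _; exists (N w). Qed.

Lemma integral_split_N (h : Omega -> \bar R) :
  (forall n, measurable_fun (N @^-1` [set n]) h) -> (forall w, 0 <= h w) ->
  \int[P]_w h w = \sum_(n <oo) \int[P]_(w in N @^-1` [set n]) h w.
Proof.
move=> mh h0; rewrite -bigcup_N ge0_integral_bigcup//.
- by move=> n; exact: measurable_N.
- by apply/measurable_fun_bigcup => // n; exact: measurable_N.
- by move=> i j _ _ [w [/= <- <-]].
Qed.

(** This is the passage from integrands that may fail to be measurable to their measurable
    versions. *)
Lemma integral_good (h h' : Omega -> \bar R) :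
  (forall w, good w -> h w = h' w) -> \int[P]_w h w = \int[P]_w h' w.
Proof.
move=> hh'; apply: (integral_off_null (N := ~` good)).
- exact/measurableC/measurable_distinct_marks.
- exact: (distinct_marksC0 XT_distr tau_distr indep).
- by move=> w /contrapT; exact: hh'.
Qed.

(** The Mecke equation at the level of counts: selecting [k] of [n + k] points leaves a Poisson
    number [n], with the factor [s^k / k!]. *)
Lemma poisson_pmf_bin n :
  (poisson_pmf s (n + k) * 'C(n + k, k)%:R = s ^+ k / k`!%:R * poisson_pmf s n)%R.
Proof.
rewrite /poisson_pmf s_gt0.
have := bin_fact (leq_addl n k); rewrite addnK => /(congr1 (fun i => i%:R : R)).
rewrite !natrM => binE.
have nz i : (i`!%:R != 0 :> R)%R by rewrite pnatr_eq0 -lt0n fact_gt0.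
have bz : ('C(n + k, k)%:R != 0 :> R)%R.
  by rewrite pnatr_eq0 -lt0n bin_gt0 leq_addl.
rewrite exprD -binE; move/eqP in bz.
have /eqP kz := nz k; have /eqP nz' := nz n.
by rfield R.
Qed.

Let Wterm n (J : {set 'I_n}) (w : Omega) : \bar R :=
  if #|J| == k then pattern_term J (sample XT n w) else 0.

Let Wterm_ge0 n (J : {set 'I_n}) w : 0 <= Wterm J w.
Proof. by rewrite /Wterm; case: ifP => // _; exact: pattern_term_ge0. Qed.

Let measurable_Wterm n (J : {set 'I_n}) : measurable_fun setT (Wterm J).
Proof.
rewrite /Wterm; case: eqP => [Jk|_]; last exact: measurable_cst.
apply: (measurableT_comp (measurable_pattern_term Jk)).
exact: measurable_sample.
Qed.

Let integral_Wterm n (J : {set 'I_n}) :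
  \int[P]_(w in N @^-1` [set n]) Wterm J w =
  if #|J| == k then P (N @^-1` [set n]) *
    \int[tuple_power muM n]_z pattern_term J z else 0.
Proof.
rewrite /Wterm; case: eqP => [Jk|_]; last by rewrite integral0.
rewrite (integral_sample XT_distr tau_distr indep)//.
  exact: measurable_pattern_term.
by move=> z; exact: pattern_term_ge0.
Qed.

Lemma integral_W :
  \int[P]_w ((F (eta w))%:R * G (F (eta w)))%:E =
  \sum_(n <oo) (s ^+ k / k`!%:R * poisson_pmf s n)%:E * pattern_mass n.
Proof.
(* The index type depends on [w]; on each event [N = n] the sum is over a fixed type, and
   measurability is checked there. *)
pose h w := \sum_(J : {set 'I_(N w)}) Wterm J w.
rewrite (@integral_good _ h); last first.
  move=> w gw; rewrite (W_sum gw erefl) big_mkcond /=.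
  by apply: eq_bigr => J _; rewrite /Wterm.
have hE n w : N w = n -> h w = \sum_(J : {set 'I_n}) Wterm J w by move=> <-.
have mh n : measurable_fun (N @^-1` [set n]) (fun w => \sum_(J : {set 'I_n}) Wterm J w).
  by apply: emeasurable_sum => J; apply: measurable_funTS; exact: measurable_Wterm.
rewrite integral_split_N; last 2 first.
- move=> n; apply: (eq_measurable_fun (fun w => \sum_(J : {set 'I_n}) Wterm J w)) => // w.
  by move=> /set_mem Nw; rewrite (hE n).
- by move=> w; apply: sume_ge0 => J _; exact: Wterm_ge0.
pose a n := \int[P]_(w in N @^-1` [set n]) h w.
have aE n : a n = \sum_(J : {set 'I_n} | #|J| == k)
    P (N @^-1` [set n]) * \int[tuple_power muM n]_z pattern_term J z.
  rewrite /a (eq_integral (fun w => \sum_(J : {set 'I_n}) Wterm J w)); last first.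
    by move=> w /set_mem Nw; exact: hE.
  rewrite ge0_integral_sum//.
  - rewrite [RHS]big_mkcond /=; apply: eq_bigr => J _; exact: integral_Wterm.
  - exact: measurable_N.
  - by move=> J; apply: measurable_funTS; exact: measurable_Wterm.
have a_lt n : (n < k)%N -> a n = 0.
  move=> nk; rewrite aE big1// => J /eqP Jk.
  by have := max_card [in J]; rewrite Jk card_ord leqNgt nk.
have a0 n : 0 <= a n.
  rewrite aE sume_ge0// => J _; rewrite mule_ge0// integral_ge0// => z _.
  exact: pattern_term_ge0.
transitivity (\sum_(n <oo) a n); first by [].
(* Fewer than [k] points have no [k]-point subset, so the series starts at [k] and is shifted to
   match [pattern_mass]. *)
rewrite (nneseries_split 0 k); last by move=> n _; exact: a0.
rewrite big_nat big1 ?add0e; last by move=> n /andP[_]; rewrite add0n => /a_lt.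
rewrite add0n -nneseries_addn//; apply: eq_eseriesr => n _.
rewrite addnC aE (eq_bigr (fun=> P (N @^-1` [set (k + n)%N]) * pattern_mass n)); last first.
  move=> J /eqP Jk; congr (_ * _).
  by apply: integral_pattern_term => //; exact: card_first_points.
rewrite N_pmf.
have -> : \sum_(J : {set 'I_(k + n)} | #|J| == k)
      (poisson_pmf s (k + n))%:E * pattern_mass n =
    ('C(k + n, k)%:R * poisson_pmf s (k + n))%:E * pattern_mass n.
  rewrite -ge0_sume_distrl; last by move=> J _; rewrite lee_fin poisson_pmf_ge0.
  congr (_ * _); rewrite sumEFin sumr_const mulr_natl; congr (_ *+ _)%:E.
  by rewrite -[in RHS](card_ord (k + n)) -card_draws cardsE.
by rewrite [(k + n)%N]addnC mulrC poisson_pmf_bin.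
Qed.

(* [p x] times the conditional mean of [G (F (pts x `|` eta))] given
   [f (pts x) eta = 1]; it is [p x] for [G = 1]. *)
Definition tilted_mean (x : k.-tuple X) : \bar R :=
  \int[P]_w ((f (pts x w) (eta w))%:R * G (F (pts x w `|` eta w)%fset))%:E.

Let tagged_term_integral n (x : k.-tuple X) : \bar R :=
  \int[P]_(w in N @^-1` [set n])
    pattern_term (first_points n) (tagged_sample XT tau n x w).

Let tagged_term_integral_ge0 n x : 0 <= tagged_term_integral n x.
Proof. by apply: integral_ge0 => w _; exact: pattern_term_ge0. Qed.

Let measurable_tagged_term_integral n : measurable_fun setT (tagged_term_integral n).
Proof.
apply: measurable_integral_tagged_sample.
  by apply: measurable_pattern_term; exact: card_first_points.
by move=> z; exact: pattern_term_ge0.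
Qed.

Lemma tilted_meanE x : tilted_mean x = \sum_(n <oo) tagged_term_integral n x.
Proof.
pose h w := pattern_term (first_points (N w)) (tagged_sample XT tau (N w) x w).
have hE n w : N w = n ->
    h w = pattern_term (first_points n) (tagged_sample XT tau n x w) by move=> <-.
rewrite /tilted_mean (@integral_good _ h); last first.
  by move=> w gw; exact: tagged_term.
have mh n : measurable_fun (N @^-1` [set n]) (fun w =>
    pattern_term (first_points n) (tagged_sample XT tau n x w)).
  apply: measurable_funTS; apply: measurableT_comp.
    by apply: measurable_pattern_term; exact: card_first_points.
  apply: (measurable_fun_pair2 (f := fun q : k.-tuple X * Omega =>
    tagged_sample XT tau n q.1 q.2)).
  exact: measurable_tagged_sample.
rewrite integral_split_N; last 2 first.
- move=> n; apply: (eq_measurable_fun (fun w =>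
    pattern_term (first_points n) (tagged_sample XT tau n x w))) => // w.
  by move=> /set_mem Nw; rewrite (hE n).
- by move=> w; exact: pattern_term_ge0.
apply: eq_eseriesr => n _; apply: eq_integral => w /set_mem Nw.
exact: hE.
Qed.

Lemma tilted_mean_ge0 x : 0 <= tilted_mean x.
Proof. by rewrite tilted_meanE nneseries_ge0. Qed.

Lemma measurable_tilted_mean : measurable_fun setT tilted_mean.
Proof.
rewrite (_ : tilted_mean = fun x => \sum_(n <oo) tagged_term_integral n x); last first.
  by apply/funext => x; exact: tilted_meanE.
exact: ge0_emeasurable_sum.
Qed.

Local Notation lambdak := (tuple_power (intensity mu (NngNum (ltW s_gt0))) k).

Lemma integral_tilted_mean :
  \int[lambdak]_x tilted_mean x =
  \sum_(n <oo) (s ^+ k * poisson_pmf s n)%:E * pattern_mass n.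
Proof.
under eq_integral do rewrite tilted_meanE.
rewrite integral_nneseries//; apply: eq_eseriesr => n _.
rewrite /tagged_term_integral (integral_tagged_sample XT_distr tau_distr indep).
- by rewrite N_pmf.
- by apply: measurable_pattern_term; exact: card_first_points.
- by move=> z; exact: pattern_term_ge0.
Qed.

(* The factor [1 / k!] turns ordered into unordered [k]-tuples of points. *)
Lemma mecke :
  \int[P]_w ((F (eta w))%:R * G (F (eta w)))%:E =
  (k`!%:R^-1)%:E * \int[lambdak]_x tilted_mean x.
Proof.
rewrite integral_W integral_tilted_mean -nneseriesZl.
  apply: eq_eseriesr => n _; rewrite muleA -EFinM; congr (_%:E * _).
  by rewrite mulrA; congr (_ * _)%R; exact: mulrC.
move=> n _; rewrite mule_ge0 ?pattern_mass_ge0// lee_fin mulr_ge0 ?poisson_pmf_ge0//.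
by rewrite exprn_ge0// ltW.
Qed.

End pattern_integrals.
End mecke.

(** * Laws of integer-valued random variables *)

Section nat_random_variables.
Context d (Om : measurableType d) (R : realType) (Q : probability Om R).
Implicit Types (Y : Om -> nat) (G : nat -> R).
Local Open Scope ereal_scope.

Lemma measurable_nat_preimage Y (B : set nat) : measurable_fun setT Y ->
  measurable (Y @^-1` B).
Proof. by move=> mY; rewrite -[X in measurable X]setTI; exact: mY. Qed.

Lemma lawE Y : measurable_fun setT Y -> law Q Y = fun B => Q (Y @^-1` B).
Proof.
move=> mY; apply/funext => B; rewrite /law /prob expectation_indic//.
exact: measurable_nat_preimage.
Qed.

Lemma measurable_nat_comp Y G : measurable_fun setT Y ->
  measurable_fun setT (fun w => (G (Y w))%:E).
Proof.
by move=> mY; apply/measurable_EFinP; apply: (measurableT_comp (f := G)).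
Qed.

Lemma integral_nat_comp Y G : measurable_fun setT Y -> (forall n, 0 <= G n)%R ->
  \int[Q]_w (G (Y w))%:E = \sum_(n <oo) (G n)%:E * law Q Y [set n].
Proof.
move=> mY G0; rewrite lawE//.
have YT : \bigcup_n Y @^-1` [set n] = setT.
  by apply/seteqP; split => // w _; exists (Y w).
rewrite -YT ge0_integral_bigcup//.
- apply: eq_eseriesr => n _.
  rewrite (eq_integral (cst (G n)%:E)); last by move=> w /set_mem /= ->.
  by rewrite integral_cst//; exact: measurable_nat_preimage.
- by move=> n; exact: measurable_nat_preimage.
- by rewrite YT; exact: measurable_nat_comp.
- by move=> w _; rewrite lee_fin.
- by move=> i j _ _ [w [/= <- <-]].
Qed.

End nat_random_variables.

(** The increments of Stein solutions are controlled only at positive arguments, hence the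
    successors throughout. *)
Lemma lipschitz_shift (R : realType) (g : nat -> R) (K : R) (a b : nat) :
  (forall j, `|g j.+2 - g j.+1| <= K) ->
  `|g a.+1 - g b.+1| <= K * `|a%:R - b%:R|.
Proof.
move=> gK.
wlog ab : a b / (b <= a)%N => [th|].
  by have [/th//|/ltnW /th] := leqP b a; rewrite distrC [X in _ * X]distrC.
rewrite -natrB// normr_nat -(subnKC ab) addKn.
elim: (a - b)%N => [|c IH]; first by rewrite addn0 subrr normr0 mulr0.
rewrite addnS -(subrK (g (b + c).+1) (g (b + c).+2)) -addrA.
rewrite (le_trans (ler_normD _ _))// -natr1 mulrDr mulr1 [leRHS]addrC.
by apply: lerD; [exact: gK|exact: IH].
Qed.

(** * Comparison of the tilted and the original count *)

Section tilted_expansion.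
Context (R : realType) (dX dM dO : measure_display).
Context (X : measurableType dX) (M : measurableType dM) (Omega : measurableType dO).
Variables (mu : probability X R) (m : probability M R) (P : probability Omega R).
Variables (XT : nat -> {mfun Omega >-> (X * M)%type}) (N : {mfun Omega >-> nat}).
Variables (tau : nat -> {mfun Omega >-> M}).
Variable s : R.
Hypothesis s_gt0 : 0 < s.
Hypothesis XT_distr : forall i A, measurable A ->
    distribution P (XT i) A = (mu \x m)%E A.
Hypothesis N_distr : forall A, distribution P N A = poisson_prob s 0 A.
Hypothesis tau_distr : forall j A, measurable A -> distribution P (tau j) A = m A.
Hypothesis indep : mutually_independent P (sources XT N tau).
Variable k : nat.
Variable f : config (X * M)%type -> config (X * M)%type -> bool.
Hypothesis f_meas : measurable_fun
    ([set psi : config (X * M)%type | #|` psi| = k] `*` setT)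
    (fun q => f q.1 q.2).
Variable A : set (M * M).
Hypotheses (mA : measurable A) (A0 : (m \x m)%E A = 0%E).
Hypothesis A_diag : forall t, A (t, t).
Local Open Scope ereal_scope.
Local Notation F := (subset_count k f).
Local Notation eta := (poisson_process XT N).
Local Notation pts := (marked_points tau).
Local Notation good := (distinct_marks XT tau A).

Section fixed_points.
Variable x : k.-tuple X.

(** The integrand of [tilted_mean], set to 0 where the marks of the tagged sample fail to be
    distinct in the sense of [A]; this makes it measurable. *)
Definition tilted_version (G : nat -> R) (w : Omega) : \bar R :=
  pattern_term k f A G (first_points k (N w)) (tagged_sample XT tau (N w) x w).

Lemma tilted_version_ge0 G w : (forall n, 0 <= G n)%R -> 0 <= tilted_version G w.
Proof. by move=> G0; exact: pattern_term_ge0. Qed.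

Lemma measurable_tilted_version G : (forall n, 0 <= G n)%R ->
  measurable_fun setT (tilted_version G).
Proof.
move=> G0.
have NT : \bigcup_n N @^-1` [set n] = setT by exact: bigcup_N.
rewrite -NT; apply/measurable_fun_bigcup => n; first exact: measurable_N.
apply: (eq_measurable_fun (fun w =>
    pattern_term k f A G (first_points k n) (tagged_sample XT tau n x w))).
  by move=> w /set_mem <-.
apply: measurable_funTS; apply: measurableT_comp.
  by apply: measurable_pattern_term => //; exact: card_first_points.
apply: (measurable_fun_pair2 (f := fun q : k.-tuple X * Omega =>
  tagged_sample XT tau n q.1 q.2)).
exact: measurable_tagged_sample.
Qed.

Lemma tilted_mean_version G : (forall n, 0 <= G n)%R ->
  tilted_mean P XT N tau f G x = \int[P]_w tilted_version G w.
Proof.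
move=> G0; apply: (integral_good XT_distr tau_distr indep mA A0) => w gw.
exact: tagged_term.
Qed.

(** The couplings are described by laws alone, so the mean of [G] has to be rebuilt from the atoms
    of the count. *)
Lemma tilted_mean_expand G : (forall n, 0 <= G n)%R ->
  tilted_mean P XT N tau f G x =
  \sum_(n <oo) (G n)%:E * tilted_mean P XT N tau f (fun i => (i == n)%:R) x.
Proof.
move=> G0; rewrite tilted_mean_version//.
have i0 (n i : nat) : (0 <= (i == n)%:R :> R)%R by [].
have -> : tilted_version G =
    fun w => \sum_(n <oo) (G n)%:E * tilted_version (fun i => (i == n)%:R) w.
  apply/funext => w; rewrite /tilted_version /pattern_term !patchE.
  set z := tagged_sample _ _ _ _ _; set J := first_points _ _.
  case: ifPn => zD; last first.
    by rewrite eseries0// => n _ _; rewrite patchE (negbTE zD) mule0.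
  set j := F _.
  rewrite (nneseriesD1 (n := j))//; last first.
    by move=> n _; rewrite mule_ge0 ?lee_fin// patchE zD lee_fin mulr_ge0.
  rewrite eseries0 ?adde0; last first.
    by move=> n _ nj; rewrite patchE zD -/j eq_sym (negbTE nj) mulr0 mule0.
  by rewrite patchE zD -/j eqxx mulr1 -EFinM mulrC.
rewrite integral_nneseries//.
- apply: eq_eseriesr => n _; rewrite tilted_mean_version// ge0_integralZl//.
  + exact: measurable_tilted_version.
  + by move=> w _; exact: tilted_version_ge0.
  + by rewrite lee_fin.
- move=> n; apply: measurable_funeM; exact: measurable_tilted_version.
- by move=> n w _; rewrite mule_ge0 ?lee_fin//; exact: tilted_version_ge0.
Qed.

Lemma tilted_mean_le (G G' : nat -> R) : (forall n, 0 <= G n <= G' n)%R ->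
  tilted_mean P XT N tau f G x <= tilted_mean P XT N tau f G' x.
Proof.
move=> GG'.
have G0 n : (0 <= G n)%R by case/andP: (GG' n).
have GGle n : (G n <= G' n)%R by case/andP: (GG' n).
have G'0 n : (0 <= G' n)%R by exact: le_trans (GGle n).
rewrite !tilted_mean_version//; apply: ge0_le_integral => //.
- by move=> w _; exact: tilted_version_ge0.
- exact: measurable_tilted_version.
- exact: measurable_tilted_version.
move=> w _; rewrite /tilted_version /pattern_term !patchE; case: ifP => // _.
by rewrite lee_fin ler_wpM2l// GGle.
Qed.

Lemma tilted_mean_scale (c : R) (G : nat -> R) : (0 <= c)%R -> (forall n, 0 <= G n)%R ->
  tilted_mean P XT N tau f (fun n => c * G n)%R x =
  c%:E * tilted_mean P XT N tau f G x.
Proof.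
move=> c0 G0; rewrite !tilted_mean_version//; last by move=> n; rewrite mulr_ge0.
rewrite -ge0_integralZl//.
- apply: eq_integral => w _; rewrite /tilted_version /pattern_term !patchE.
  by case: ifP => _; rewrite ?mule0// -EFinM mulrCA.
- exact: measurable_tilted_version.
- by move=> w _; exact: tilted_version_ge0.
Qed.

Lemma tilted_mean1_le1 : tilted_mean P XT N tau f (fun=> 1%R) x <= 1.
Proof.
rewrite tilted_mean_version//.
have <- : \int[P]_w (cst 1 w) = 1 by rewrite integral_cst// mul1e; exact: probability_setT.
apply: ge0_le_integral => //.
- by move=> w _; exact: tilted_version_ge0.
- exact: measurable_tilted_version.
move=> w _; rewrite /tilted_version /pattern_term patchE; case: ifP => // _.
by rewrite /= mulr1 lee_fin lern1 leq_b1.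
Qed.

Local Notation p := (tilted_mean P XT N tau f (fun=> 1%R) x).

(** By hypothesis (ii) the tilted mean is [p * E G(1 + V)], by (i) the other term is
    [p * E G(1 + U)], and [G] is Lipschitz at positive arguments. Two additive inequalities replace
    an absolute difference, since for this [G] the means may be infinite. *)
Lemma tilted_mean_coupling dQ (Om : measurableType dQ) (Q : probability Om R)
    (U V : {mfun Om >-> nat}) (W : Omega -> nat) (wx K : R) (G : nat -> R) :
  0 < p -> measurable_fun setT W ->
  (0 <= K)%R -> (forall n, 0 <= G n)%R -> (forall j, `|G j.+2 - G j.+1| <= K)%R ->
  law Q U = law P W ->
  law Q (fun o => (1 + V o)%N) =
    cond_law P (fun o => F (pts x o `|` eta o)%fset) [set o | f (pts x o) (eta o)] ->
  'E_Q[fun o => `|(U o)%:R - (V o)%:R|%R] <= wx%:E ->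
  tilted_mean P XT N tau f G x <=
    p * \int[P]_w (G (W w).+1)%:E + K%:E * (wx%:E * p) /\
  p * \int[P]_w (G (W w).+1)%:E <=
    tilted_mean P XT N tau f G x + K%:E * (wx%:E * p).
Proof.
move=> p0 mW K0 G0 GK lawU lawV UVw.
have pfin : p \is a fin_num.
  by rewrite ge0_fin_numE ?(ltW p0)// (le_lt_trans tilted_mean1_le1)// ltry.
have prE : prob P [set o | f (pts x o) (eta o)] = p.
  rewrite /prob unlock; apply: eq_integral => w _.
  rewrite indicE mulr1; congr (_%:R)%:E; congr nat_of_bool.
  by apply/idP/idP => [/set_mem//|fw]; exact: mem_set.
have mV1 : measurable_fun setT (fun o => (1 + V o)%N).
  by apply: (measurableT_comp (f := addn 1)).
have tV : tilted_mean P XT N tau f G x = p * \int[Q]_o (G (1 + V o)%N)%:E.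
  rewrite (integral_nat_comp Q mV1 G0) tilted_mean_expand// -{1}(fineK pfin).
  rewrite -nneseriesZl; last first.
    move=> n _; rewrite mule_ge0 ?lee_fin// lawE//.
  apply: eq_eseriesr => n _; rewrite lawV /cond_law prE muleCA; congr (_ * _).
  have -> : prob P ((fun o => F (pts x o `|` eta o)%fset) @^-1` [set n] `&`
      [set o | f (pts x o) (eta o)]) =
      tilted_mean P XT N tau f (fun i => (i == n)%:R) x.
    rewrite /prob unlock; apply: eq_integral => w _.
    rewrite indicE -natrM mulnb; congr (_%:R)%:E; congr nat_of_bool.
    apply/idP/idP => [/set_mem[/= -> ->]//|/andP[fw /eqP Fw]].
      by rewrite eqxx.
    by apply/mem_set; split.
  rewrite muleA -EFinM mulfV ?mul1e//.
  by rewrite gt_eqF// fine_gt0// p0 (le_lt_trans tilted_mean1_le1)// ltry.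
have EU : \int[P]_w (G (W w).+1)%:E = \int[Q]_o (G (U o).+1)%:E.
  rewrite (integral_nat_comp (G := fun n => G n.+1) P mW)//.
  by rewrite (integral_nat_comp (G := fun n => G n.+1) Q (measurable_funP U))// lawU.
have mUV : measurable_fun setT (fun o => (`|(U o)%:R - (V o)%:R|%R)%:E : \bar R).
  apply/measurable_EFinP; apply: measurableT_comp => //.
  by apply: measurable_funB; apply: (measurableT_comp (f := fun n : nat => n%:R : R)).
have mG Y : measurable_fun setT Y -> measurable_fun setT (fun o : Om => (G (Y o))%:E).
  exact: measurable_nat_comp.
have mU1 : measurable_fun setT (fun o => (U o).+1).
  by apply: (measurableT_comp (f := succn)).
have key (Y1 Y2 : Om -> nat) : measurable_fun setT Y1 -> measurable_fun setT Y2 ->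
    (forall o, (G (Y1 o) <= G (Y2 o) + K * `|(U o)%:R - (V o)%:R|)%R) ->
    \int[Q]_o (G (Y1 o))%:E <= \int[Q]_o (G (Y2 o))%:E + K%:E * wx%:E.
  move=> mY1 mY2 Y12.
  apply: (@le_trans _ _ (\int[Q]_o ((G (Y2 o))%:E +
      K%:E * (`|(U o)%:R - (V o)%:R|%R)%:E))).
    apply: ge0_le_integral => //.
    - by move=> o _; rewrite lee_fin.
    - exact: mG.
    - by apply: emeasurable_funD; [exact: mG|exact: measurable_funeM].
    - by move=> o _; rewrite -EFinM -EFinD lee_fin.
  rewrite ge0_integralD//.
  - rewrite ge0_integralZl//.
    rewrite leeD2l// lee_wpmul2l ?lee_fin//.
    by move: UVw; rewrite unlock.
  - by move=> o _; rewrite lee_fin.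
  - exact: mG.
  - by move=> o _; rewrite -EFinM lee_fin mulr_ge0.
  - exact: measurable_funeM.
have wx0 : 0 <= wx%:E.
  by apply: le_trans UVw; apply: expectation_ge0 => o; exact: normr_ge0.
have Kwx0 : 0 <= K%:E * wx%:E by exact: mule_ge0.
have G1 Y : 0 <= \int[Q]_o (G (Y o))%:E.
  by apply: integral_ge0 => o _; rewrite lee_fin.
have pK : K%:E * (wx%:E * p) = p * (K%:E * wx%:E) by rewrite muleA muleC.
have GUV o : (`|G (1 + V o)%N - G (U o).+1| <= K * `|(U o)%:R - (V o)%:R|)%R.
  by rewrite add1n [X in (_ <= _ * X)%R]distrC; exact: lipschitz_shift.
rewrite tV EU pK -!ge0_muleDr//; split; apply: lee_wpmul2l (ltW p0) _ _ _;
  apply: key => // o.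
- by rewrite addrC -lerBlDr (le_trans (ler_norm _)).
- rewrite addrC -lerBlDr (le_trans (ler_norm _))//.
  by rewrite distrC.
Qed.

End fixed_points.
End tilted_expansion.

(** * Truncation and the Poisson approximation error *)

Section expectations_on_nat.
Context d (Om : measurableType d) (R : realType) (Q : probability Om R).
Local Open Scope ereal_scope.

Lemma integrable_norm_le (h : Om -> R) (C : R) : measurable_fun setT h ->
  (forall w, `|h w| <= C)%R -> Q.-integrable setT (EFin \o h).
Proof.
move=> mh hC; apply: (le_integrable measurableT _ _
  (finite_measure_integrable_cst Q C measurableT)).
  exact/measurable_EFinP.
by move=> w _; rewrite lee_fin (le_trans (hC w))// ler_norm.
Qed.

Lemma affine_integrable (W : Om -> nat) (h : nat -> R) (C : R) :
  measurable_fun setT W -> \int[Q]_w ((W w)%:R)%:E < +oo ->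
  (forall n, `|h n| <= C + n%:R)%R -> Q.-integrable setT (fun w => (h (W w))%:E).
Proof.
move=> mW Woo hC.
have mWR : measurable_fun setT (fun w => ((W w)%:R : R)).
  by apply: (measurableT_comp (f := fun n : nat => n%:R : R)).
have iW : Q.-integrable setT (EFin \o (fun w => ((W w)%:R : R))).
  apply/integrableP; split; first exact/measurable_EFinP.
  by under eq_integral do rewrite /= normr_nat.
have iC : Q.-integrable setT (EFin \o (fun w => (C + (W w)%:R)%R)).
  have := integrableD measurableT (finite_measure_integrable_cst Q C measurableT) iW.
  by apply: eq_integrable.
apply: (le_integrable measurableT _ _ iC).
  exact: measurable_nat_comp.
by move=> w _; rewrite lee_fin (le_trans (hC _))// ler_norm.
Qed.

Lemma lipschitz_growth (h : nat -> R) : (forall i, `|h i.+1 - h i| <= 1)%R ->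
  forall n, (`|h n| <= `|h 0%N| + n%:R)%R.
Proof.
move=> h1; elim=> [|n IH]; first by rewrite addr0.
rewrite -(subrK (h n) (h n.+1)) (le_trans (ler_normD _ _))// -natr1.
by rewrite addrA [leRHS]addrC lerD.
Qed.

(** Dominated convergence with envelope [|h 0| + W]. It serves both for the count and for the
    Poisson law, and lets a bound uniform in [L] pass from truncations to [h]. *)
Lemma integral_trunc_cvg (W : Om -> nat) (h : nat -> R) :
  measurable_fun setT W -> \int[Q]_w ((W w)%:R)%:E < +oo ->
  (forall i, `|h i.+1 - h i| <= 1)%R ->
  \int[Q]_w (h (W w))%:E \is a fin_num /\
  (fun L => \int[Q]_w (h (minn (W w) L))%:E) @ \oo --> \int[Q]_w (h (W w))%:E.
Proof.
move=> mW Woo h1; have hC := lipschitz_growth h1.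
have ih := affine_integrable mW Woo hC.
split; first exact: integrable_fin_num.
have [] := @dominated_convergence _ _ R Q setT measurableT
  (fun L w => (h (minn (W w) L))%:E) (fun w => (h (W w))%:E)
  (fun w => (`|h 0%N| + (W w)%:R)%:E) _ _ _ _ _ => //.
- by move=> L; apply: (measurable_nat_comp (fun n => h (minn n L))).
- exact: measurable_nat_comp.
- apply: aeW => w _; apply: cvg_near_cst.
  by exists (W w) => // n /= Wn; rewrite (minn_idPl Wn).
- have gC n : (`| (`|h 0%N| + n%:R : R) | <= `|h 0%N| + n%:R)%R.
    by rewrite ger0_norm// addr_ge0.
  exact: affine_integrable gC.
- apply: aeW => w L _; rewrite lee_fin (le_trans (hC _))// lerD2l ler_nat.
  exact: geq_minl.
Qed.

End expectations_on_nat.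

(** * Poisson expectations of eventually constant functions *)

Section poisson_expectations.
Context (R : realType) (a : R).
Hypothesis a_gt0 : 0 < a.
Local Open Scope ereal_scope.
Local Notation Z := (poisson_prob a 0).

Lemma poisson_prob_below m : Z [set n | (n < m)%N] = (poisson_below a m)%:E.
Proof.
rewrite /poisson_prob a_gt0 esum_fset; last 2 first.
- exact: finite_II.
- by move=> i _; rewrite lee_fin poisson_pmf_ge0.
rewrite -(fsbig_ord _ m (fun n => (poisson_pmf a n)%:E)) sumEFin.
by rewrite /poisson_below big_mkord.
Qed.

Lemma poisson_prob_above l : Z [set n | (l < n)%N] = (poisson_above a l.+1)%:E.
Proof.
rewrite (_ : [set n | _] = ~` [set n | (n < l.+1)%N]); last first.
  by apply/seteqP; split => n /=; rewrite ltnS leqNgt => /negP; rewrite ?negbK.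
transitivity (1 - Z [set n | (n < l.+1)%N]); first exact: probability_setC.
by rewrite poisson_prob_below -EFinB.
Qed.

(** Since [n.+1 * pi n.+1 = a * pi n], partial sums of the mean are [a] times partial sums of the
    total mass. *)
Lemma poisson_prob_mean_lty : \int[Z]_n (n%:R)%:E < +oo.
Proof.
have mid : measurable_fun setT (@id nat) by exact: measurable_id.
rewrite (@integral_nat_comp _ _ _ Z id (fun n => n%:R))//.
apply: (@le_lt_trans _ _ a%:E); last exact: ltry.
apply: lime_le.
  by apply: is_cvg_nneseries => n _ _; rewrite mule_ge0 ?lee_fin// lawE.
apply: nearW => m.
have -> : \sum_(0 <= n < m) (n%:R)%:E * law Z id [set n] =
    (\sum_(0 <= n < m) n%:R * poisson_pmf a n)%:E.
  rewrite -sumEFin; apply: eq_bigr => n _; rewrite lawE//= EFinM; congr (_ * _).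
  by rewrite /poisson_prob a_gt0 esum_set1// lee_fin poisson_pmf_ge0.
rewrite lee_fin; case: m => [|m]; first by rewrite big_geq// ltW.
rewrite big_nat_recl//= mul0r add0r.
under eq_bigr do rewrite poisson_pmfS//.
by rewrite -mulr_sumr ler_piMr ?(ltW a_gt0)//; exact: poisson_below_le1.
Qed.

Lemma integral_poisson_trunc (h : nat -> R) (L : nat) :
  (forall n, (L <= n)%N -> h n = h L) ->
  \int[Z]_n (h n)%:E = (poisson_mean_trunc a h L)%:E.
Proof.
move=> hL.
have iI l : Z.-integrable setT (fun n => ((h l.+1 - h l) * (l < n)%:R)%:E).
  apply: (@integrable_norm_le _ _ _ Z (fun n => (h l.+1 - h l) * (l < n)%:R)%R
    (`|h l.+1 - h l|)%R) => // n.
  by rewrite normrM normr_nat ler_piMr// lern1 leq_b1.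
rewrite (eq_integral (fun n => cst (h 0%N)%:E n +
    \sum_(0 <= l < L) ((h l.+1 - h l) * (l < n)%:R)%:E)); last first.
  by move=> n _; rewrite sumEFin -EFinD -truncE.
rewrite integralD//; last 2 first.
- exact: finite_measure_integrable_cst.
- exact: integrable_sum.
rewrite integral_cst// integral_sum//.
rewrite /poisson_mean_trunc EFinD; congr (_ + _).
  by rewrite -[RHS]mule1; congr (_ * _); exact: probability_setT.
rewrite -sumEFin; apply: eq_bigr => l _.
rewrite (eq_integral (fun n => (h l.+1 - h l)%:E * (\1_[set n | (l < n)%N] n)%:E)); last first.
  by move=> n _; rewrite EFinM indicE mem_setE.
rewrite integralZl//; last by apply: (@integrable_norm_le _ _ _ Z _ 1%R) => // n;
  rewrite indicE normr_nat lern1 leq_b1.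
by rewrite integral_indic// setIT EFinM; congr (_ * _); exact: poisson_prob_above.
Qed.

End poisson_expectations.

Section stein_discrepancy.
Context d (Om : measurableType d) (R : realType) (P : probability Om R).
Variables (W : Om -> nat) (a : R).
Hypotheses (mW : measurable_fun setT W) (a_gt0 : 0 < a).
Local Open Scope ereal_scope.
Add Field Rfield : (@F_field_theory R)
  (morphism (@F_morph R), constants [field_cst], power_tac (@F_power R) [nat_cst]).
Hypothesis EW : \int[P]_w ((W w)%:R)%:E = a%:E.

Lemma abse_sub_le (x y B : \bar R) : x \is a fin_num -> y \is a fin_num ->
  x <= y + B -> y <= x + B -> `|x - y| <= B.
Proof.
move: x y B => [x| |] [y| |] [b| |] // _ _; rewrite -?EFinD ?lee_fin ?leey//.
move=> xy yx; rewrite ler_norml; apply/andP; split; last by rewrite lerBlDl.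
by rewrite lerNl opprB lerBlDl.
Qed.

(* The shift by [1] makes [G] nonnegative, so that the Mecke equation applies to it. *)
Lemma stein_discrepancy (h : nat -> R) (L : nat) (B : \bar R) :
  let G n := (stein a h L n + 1)%R in
  (forall n, (L <= n)%N -> h n = h L) -> (forall i, `|h i.+1 - h i| <= 1)%R ->
  \int[P]_w ((W w)%:R * G (W w))%:E <= a%:E * \int[P]_w (G (W w).+1)%:E + B ->
  a%:E * \int[P]_w (G (W w).+1)%:E <= \int[P]_w ((W w)%:R * G (W w))%:E + B ->
  `|\int[P]_w (h (W w))%:E - \int[poisson_prob a 0]_n (h n)%:E| <= B.
Proof.
move=> G hL h1 I1 I2; rewrite (integral_poisson_trunc a_gt0 hL).
have g1 n := stein_le1 a_gt0 L n h1.
have Woo : \int[P]_w ((W w)%:R)%:E < +oo by rewrite EW ltry.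
have GC n : (`|G n| <= 2)%R.
  by rewrite (le_trans (ler_normD _ _))// normr1 -[leRHS]natr1 lerD.
have ih := affine_integrable mW Woo (lipschitz_growth h1).
have iG1 : P.-integrable setT (fun w => (G (W w).+1)%:E).
  apply: (@affine_integrable _ _ _ P W (fun n => G n.+1) 2%R mW Woo) => n.
  by rewrite (le_trans (GC _))// lerDl.
pose c := poisson_mean_trunc a h L.
have iaff (r : R) : P.-integrable setT (fun w => (r + (W w)%:R)%:E).
  apply: (@affine_integrable _ _ _ P W (fun n => r + n%:R)%R `|r|%R mW Woo) => n.
  by rewrite (le_trans (ler_normD _ _))// normr_nat.
(* Adding 1 to the Stein solution adds [a - W] to Stein's equation, and this term has mean 0 by
   [EW]. *)
have idE w : (a * G (W w).+1 - (W w)%:R * G (W w) = h (W w) - (c - a + (W w)%:R))%R.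
  apply: (eq_by (c := 1%R) (steinE a_gt0 hL (W w))).
  by rewrite /G /c; rring R.
have iWg : P.-integrable setT (fun w => ((W w)%:R * stein a h L (W w))%:E).
  apply: (@affine_integrable _ _ _ P W (fun n => n%:R * stein a h L n)%R 0%R mW Woo) => n.
  by rewrite normrM normr_nat add0r ler_piMr.
have iWG : P.-integrable setT (fun w => ((W w)%:R * G (W w))%:E).
  apply: eq_integrable (integrableD measurableT iWg (iaff 0%R)) => // w _.
  by rewrite /= add0r -EFinD; congr EFin; rewrite /G; rring R.
have iaG1 : P.-integrable setT (fun w => (a * G (W w).+1)%:E).
  exact: (integrableZl measurableT a iG1).
have aG1E : \int[P]_w (a * G (W w).+1)%:E = a%:E * \int[P]_w (G (W w).+1)%:E.
  by under eq_integral do rewrite EFinM; rewrite integralZl.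
have diffE : \int[P]_w (h (W w))%:E - c%:E =
    a%:E * \int[P]_w (G (W w).+1)%:E - \int[P]_w ((W w)%:R * G (W w))%:E.
  rewrite -aG1E -integralB_EFin//.
  under [RHS]eq_integral do rewrite -EFinB idE EFinB.
  rewrite integralB_EFin//; last exact: iaff.
  congr (_ - _).
  under eq_integral do rewrite EFinD.
  rewrite integralD_EFin//; last 2 first.
  - exact: finite_measure_integrable_cst.
  - by apply: eq_integrable (iaff 0%R) => // w _; rewrite /= add0r.
  transitivity ((c - a)%:E + a%:E); first by rewrite -EFinD subrK.
  congr (_ + _); last by rewrite -EW.
  rewrite [RHS](integral_cst P measurableT (c - a)%:E) -[LHS]mule1.
  by congr (_ * _); apply/esym; exact: probability_setT.
rewrite -/c diffE; apply: abse_sub_le => //.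
- by rewrite -aG1E; exact: integrable_fin_num.
- exact: integrable_fin_num.
Qed.

End stein_discrepancy.

(** * The coupling bound *)

Section measurable_count.
Context (R : realType) (dX dM dO : measure_display).
Context (X : measurableType dX) (M : measurableType dM) (Omega : measurableType dO).
Variables (mu : probability X R) (m : probability M R) (P : probability Omega R).
Variables (XT : nat -> {mfun Omega >-> (X * M)%type}) (N : {mfun Omega >-> nat}).
Variables (tau : nat -> {mfun Omega >-> M}).
Hypothesis XT_distr : forall i A, measurable A ->
    distribution P (XT i) A = (mu \x m)%E A.
Hypothesis tau_distr : forall j A, measurable A -> distribution P (tau j) A = m A.
Hypothesis indep : mutually_independent P (sources XT N tau).
Variable k : nat.
Variable f : config (X * M)%type -> config (X * M)%type -> bool.
Hypothesis f_meas : measurable_fun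
    ([set psi : config (X * M)%type | #|` psi| = k] `*` setT)
    (fun q => f q.1 q.2).
Variable A : set (M * M).
Hypotheses (mA : measurable A) (A0 : (m \x m)%E A = 0%E).
Hypothesis A_diag : forall t, A (t, t).
Local Notation W := (fun w => subset_count k f (poisson_process XT N w)).
Local Notation good := (distinct_marks XT tau A).

(* Where marks coincide, [W] need not be measurable. *)
Definition count_version (w : Omega) : nat := if w \in good then W w else 0%N.

Lemma count_versionE w : good w -> count_version w = W w.
Proof. by move=> /mem_set gw; rewrite /count_version gw. Qed.

Lemma measurable_count_version : measurable_fun setT count_version.
Proof.
rewrite -(bigcup_N N); apply/measurable_fun_bigcup => n; first exact: measurable_N.
apply: (eq_measurable_fun (fun w => if w \in good then
    subset_count k f (subconfig [set: 'I_n]%SET (sample XT n w)) else 0%N)).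
  by move=> w /set_mem Nw; rewrite /count_version (poisson_process_sample XT Nw).
have mgood : measurable good by exact: measurable_distinct_marks.
have mD := @measurable_distinct_tuples _ _ X M _ mA n.
have Dinj := @distinct_tuples_inj _ _ X M _ A_diag n.
apply: measurable_funTS; apply: measurable_fun_if => //.
- apply: (measurable_fun_bool true); rewrite setTI.
  rewrite (_ : _ @^-1` _ = good)//.
  by apply/seteqP; split => w /=; [exact: set_mem|exact: mem_set].
- apply: (@measurable_comp _ _ _ _ _ _ (@distinct_tuples _ _ X M A n)
    (fun z => subset_count k f (subconfig [set: 'I_n]%SET z)) _ (sample XT n)) => //.
  + move=> _ [w [_ /set_mem gw] <-]; exact: distinct_sample gw.
  + exact: measurable_subset_count f_meas.
  + apply: measurable_funTS; exact: measurable_sample.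
Qed.

Lemma law_count_version : law P W = law P count_version.
Proof.
apply/funext => B; rewrite /law /prob unlock.
apply: (integral_good XT_distr tau_distr indep mA A0) => w gw.
rewrite !indicE; congr (_%:R)%:E; congr nat_of_bool.
by apply/idP/idP => /set_mem /= BW; apply/mem_set => /=; move: BW; rewrite count_versionE.
Qed.

End measurable_count.

Lemma trunc_lipschitz (R : realType) (h : nat -> R) (L : nat) :
  (forall i, `|h i.+1 - h i| <= 1) ->
  forall i, `|h (minn i.+1 L) - h (minn i L)| <= 1.
Proof.
move=> h1 i; have [iL|Li] := ltnP i L; last first.
  by rewrite (minn_idPr (leqW Li)) subrr normr0.
by rewrite (minn_idPl iL).
Qed.

Section coupling.
Context (R : realType) (dX dM dO : measure_display).
Context (X : measurableType dX) (M : measurableType dM) (Omega : measurableType dO).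
Variables (mu : probability X R) (m : probability M R) (P : probability Omega R).
Variables (XT : nat -> {mfun Omega >-> (X * M)%type}) (N : {mfun Omega >-> nat}).
Variables (tau : nat -> {mfun Omega >-> M}).
Variable s : R.
Hypothesis s_gt0 : 0 < s.
Hypothesis XT_distr : forall i A, measurable A ->
    distribution P (XT i) A = (mu \x m)%E A.
Hypothesis N_distr : forall A, distribution P N A = poisson_prob s 0 A.
Hypothesis tau_distr : forall j A, measurable A -> distribution P (tau j) A = m A.
Hypothesis indep : mutually_independent P (sources XT N tau).
Variable k : nat.
Variable f : config (X * M)%type -> config (X * M)%type -> bool.
Hypothesis f_meas : measurable_fun
    ([set psi : config (X * M)%type | #|` psi| = k] `*` setT)
    (fun q => f q.1 q.2).
Variable A : set (M * M).
Hypotheses (mA : measurable A) (A0 : (m \x m)%E A = 0%E).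
Hypothesis A_diag : forall t, A (t, t).
Local Open Scope ereal_scope.
Local Notation F := (subset_count k f).
Local Notation eta := (poisson_process XT N).
Local Notation pts := (marked_points tau).
Local Notation W := (count_version XT N tau k f A).
Local Notation lambdak := (tuple_power (intensity mu (NngNum (ltW s_gt0))) k).
Local Notation tilted G := (@tilted_mean R _ _ _ X M Omega P XT N tau k f G).
Local Notation p := (tilted (fun=> 1%R)).

Let mW : measurable_fun setT W.
Proof. exact: measurable_count_version. Qed.

Let mp : measurable_fun setT p.
Proof. by apply: (measurable_tilted_mean XT_distr tau_distr indep f_meas mA A0 A_diag). Qed.

Let p_ge0 x : 0 <= p x.
Proof. by apply: (tilted_mean_ge0 XT_distr tau_distr indep f_meas mA A0 A_diag). Qed.

Lemma mecke_version (G : nat -> R) : (forall n, 0 <= G n)%R ->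
  \int[P]_o ((W o)%:R * G (W o))%:E =
  (k`!%:R^-1)%:E * \int[lambdak]_x tilted G x.
Proof.
move=> G0; rewrite -(mecke s_gt0 XT_distr N_distr tau_distr indep f_meas mA A0 A_diag G0).
apply: (integral_good XT_distr tau_distr indep mA A0) => o go.
by rewrite count_versionE.
Qed.

Lemma mean_count_version :
  \int[P]_o ((W o)%:R)%:E = (k`!%:R^-1)%:E * \int[lambdak]_x p x.
Proof.
rewrite -mecke_version//; apply: eq_integral => o _.
by rewrite mulr1.
Qed.

Lemma mean_count_version_fin : \int[P]_o ((W o)%:R)%:E \is a fin_num.
Proof.
rewrite mean_count_version fin_numM//.
rewrite ge0_fin_numE; last by apply: integral_ge0 => x _; exact: p_ge0.
apply: (@le_lt_trans _ _ (\int[lambdak]_x (cst 1 x))).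
  apply: ge0_le_integral => //.
  by move=> x _; exact: (tilted_mean1_le1 XT_distr tau_distr indep f_meas mA A0 A_diag).
by rewrite integral_cst// mul1e ltey_eq fin_num_measure.
Qed.

Variable w : k.-tuple X -> R.
Hypotheses (w_meas : measurable_fun setT w) (w_ge0 : forall x, (0 <= w x)%R).
Hypothesis couplings : {ae lambdak, forall x, 0 < p x ->
    exists (dQ : measure_display) (Omega' : measurableType dQ)
      (Q : probability Omega' R) (U V : {mfun Omega' >-> nat}),
    [/\ law Q U = law P W,
        law Q (fun o => (1 + V o)%N) =
          cond_law P (fun o => F (pts x o `|` eta o)%fset)
            [set o | f (pts x o) (eta o)]
      & 'E_Q[fun o => `|(U o)%:R - (V o)%:R|%R] <= (w x)%:E]}.

Local Notation a := (fine (\int[P]_o ((W o)%:R)%:E)).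
Local Notation J := (\int[lambdak]_x ((w x)%:E * p x)).

Lemma size_bias_le (G : nat -> R) (K C : R) : (0 <= K)%R ->
  (forall n, 0 <= G n <= C)%R -> (forall j, `|G j.+2 - G j.+1| <= K)%R ->
  \int[P]_o ((W o)%:R * G (W o))%:E <=
    a%:E * \int[P]_o (G (W o).+1)%:E + (K / k`!%:R)%:E * J /\
  a%:E * \int[P]_o (G (W o).+1)%:E <=
    \int[P]_o ((W o)%:R * G (W o))%:E + (K / k`!%:R)%:E * J.
Proof.
move=> K0 GC GK.
have G0 n : (0 <= G n)%R by case/andP: (GC n).
have C0 : (0 <= C)%R by apply: le_trans (G0 0%N) _; case/andP: (GC 0%N).
set c := \int[P]_o (G (W o).+1)%:E.
have c0 : 0 <= c by apply: integral_ge0 => o _; rewrite lee_fin.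
have cfin : c \is a fin_num.
  rewrite ge0_fin_numE// (@le_lt_trans _ _ (\int[P]_o (cst C%:E o)))//.
    apply: ge0_le_integral => //.
    - by move=> o _; rewrite lee_fin.
    - exact: (measurable_nat_comp (fun n => G n.+1)).
    - by move=> o _; rewrite lee_fin; case/andP: (GC (W o).+1).
  by rewrite integral_cst// ltey_eq fin_numM ?fin_num_measure.
have mtG : measurable_fun setT (tilted G).
  exact: (measurable_tilted_mean XT_distr tau_distr indep f_meas mA A0 A_diag).
have tG0 x : 0 <= tilted G x.
  exact: (tilted_mean_ge0 XT_distr tau_distr indep f_meas mA A0 A_diag).
have mwp : measurable_fun setT (fun x => (w x)%:E * p x).
  by apply: emeasurable_funM => //; exact/measurable_EFinP.
have wp0 x : 0 <= (w x)%:E * p x by rewrite mule_ge0// lee_fin.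
have mKwp : measurable_fun setT (fun x => K%:E * ((w x)%:E * p x)).
  exact: measurable_funeM.
have Kwp0 x : 0 <= K%:E * ((w x)%:E * p x) by rewrite mule_ge0.
have mcp : measurable_fun setT (fun x => c * p x) by exact: measurable_funeM.
have cp0 x : 0 <= c * p x by exact: mule_ge0.
have tilted_bounds : {ae lambdak, forall x,
    tilted G x <= c * p x + K%:E * ((w x)%:E * p x) /\
    c * p x <= tilted G x + K%:E * ((w x)%:E * p x)}.
  apply: filterS couplings => x xP.
  (* Where [p x = 0] no coupling is given; there the tilted mean vanishes as well, being at most
     [C * p x]. *)
  have := p_ge0 x; rewrite le_eqVlt => /orP[/eqP p0|p0].
    have : tilted G x <= C%:E * p x.
      rewrite -(tilted_mean_scale XT_distr tau_distr indep f_meas mA A0 A_diag)//.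
      apply: (tilted_mean_le XT_distr tau_distr indep f_meas mA A0 A_diag) => // n.
      by rewrite mulr1.
    by rewrite -p0 !mule0 adde0 => ->; rewrite adde0.
  have [dQ [Om [Q [U [V [lU lV UV]]]]]] := xP p0.
  rewrite muleC.
  exact: (tilted_mean_coupling XT_distr tau_distr indep f_meas mA A0 A_diag p0 mW
    K0 G0 GK lU lV UV).
have kV : 0 <= (k`!%:R^-1)%:E :> \bar R by rewrite lee_fin.
(* The Mecke equation with [G = 1] makes [a] an integral of [p], so both sides become integrals over
   [x] and can be compared pointwise. *)
have acE : a%:E * c = (k`!%:R^-1)%:E * \int[lambdak]_x (c * p x).
  rewrite fineK; last exact: mean_count_version_fin.
  rewrite mean_count_version -muleA; congr (_ * _).
  have cE : c = (fine c)%:E by rewrite fineK.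
  have cr : (0 <= fine c)%R by exact: fine_ge0.
  rewrite cE; move: (fine c) cr => r r0.
  by rewrite muleC -[LHS]ge0_integralZl.
have KJE : (K / k`!%:R)%:E * J =
    (k`!%:R^-1)%:E * \int[lambdak]_x (K%:E * ((w x)%:E * p x)).
  by rewrite mulrC EFinM -muleA ge0_integralZl.
rewrite acE KJE mecke_version// -!ge0_muleDr//; last 4 first.
- exact: integral_ge0.
- exact: integral_ge0.
- exact: integral_ge0.
- exact: integral_ge0.
rewrite -!ge0_integralD//; split; apply: lee_wpmul2l => //;
  apply: ae_ge0_le_integral => //.
- by move=> x _; rewrite adde_ge0.
- exact: emeasurable_funD.
- by apply: filterS tilted_bounds => x [].
- by move=> x _; rewrite adde_ge0.
- exact: emeasurable_funD.
- by apply: filterS tilted_bounds => x [].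
Qed.

(** The increment bound [K] is required for the truncations of [h] uniformly in [L]; the estimate
    for each truncation then passes to the limit. *)
Lemma poisson_discrepancy (h : nat -> R) (K : R) : (0 < a)%R -> (0 <= K)%R ->
  (forall i, `|h i.+1 - h i| <= 1)%R ->
  (forall L j, `|stein a (fun n => h (minn n L)) L j.+2 -
                 stein a (fun n => h (minn n L)) L j.+1| <= K)%R ->
  `|\int[P]_o (h (W o))%:E - \int[poisson_prob a 0]_n (h n)%:E| <=
    (K / k`!%:R)%:E * J.
Proof.
move=> a0 K0 h1 hK.
have EWE : \int[P]_o ((W o)%:R)%:E = a%:E.
  by rewrite fineK//; exact: mean_count_version_fin.
have Woo : \int[P]_o ((W o)%:R)%:E < +oo by rewrite EWE ltry.
have [hfin hcvg] := integral_trunc_cvg mW Woo h1.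
have mid : measurable_fun setT (@id nat) by exact: measurable_id.
have [_ Zcvg] := @integral_trunc_cvg _ _ _ (poisson_prob a 0) id h mid
  (poisson_prob_mean_lty a0) h1.
apply: (cvge_le _ (cvg_abse (cvgeB (fin_num_adde_defr _ hfin) hcvg Zcvg))).
apply: nearW => L.
have hL n : (L <= n)%N -> h (minn n L) = h (minn L L).
  by move=> Ln; rewrite (minn_idPr Ln) minnn.
have hL1 := trunc_lipschitz L h1.
have g1 n := stein_le1 a0 L n hL1.
(* The solution lies in [[-1, 1]], hence the shifted one in [[0, 2]]: nonnegativity serves the Mecke
   equation, boundedness the points with [p x = 0]. *)
have GC n : (0 <= stein a (fun n => h (minn n L)) L n + 1 <= 2)%R.
  by have := g1 n; rewrite ler_norml => /andP[g_ge g_le]; rewrite -lerBlDr sub0r g_ge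
    -[leRHS]natr1 lerD2r.
have [] := @size_bias_le (fun n => stein a (fun n => h (minn n L)) L n + 1)%R K 2 K0 GC.
  by move=> j; rewrite opprD addrACA subrr addr0; exact: hK.
exact: (stein_discrepancy mW a0 EWE hL hL1).
Qed.

(** A count of mean 0 vanishes almost surely, and [poisson_prob] at parameter 0 is the Dirac mass at
    0. *)
Lemma discrepancy_mean0 (h : nat -> R) : (a = 0)%R ->
  \int[P]_o (h (W o))%:E - \int[poisson_prob a 0]_n (h n)%:E = 0.
Proof.
move=> a0.
have mWR : measurable_fun setT (fun o => ((W o)%:R)%:E : \bar R).
  exact: (measurable_nat_comp (fun n => n%:R : R)).
have W0 : {ae P, forall o, W o = 0%N}.
  have : \int[P]_o `|((W o)%:R)%:E| = 0.
    under eq_integral do rewrite abse_EFin normr_nat.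
    by rewrite -[LHS]fineK ?a0//; exact: mean_count_version_fin.
  move=> /(ae_eq_integral_abs P measurableT mWR); apply: filterS => o /(_ Logic.I).
  by move=> /= [/eqP]; rewrite pnatr_eq0 => /eqP.
rewrite (@ae_eq_integral _ _ _ P setT (cst (h 0%N)%:E))//; last 2 first.
- exact: measurable_nat_comp.
- by apply: filterS W0 => o /= -> _.
have -> : \int[P]_o cst (h 0%N)%:E o = (h 0%N)%:E.
  by rewrite integral_cst// -[RHS]mule1; congr (_ * _); exact: probability_setT.
rewrite (_ : poisson_prob a 0 = \d_0%N); last first.
  by apply/funext => B; rewrite /poisson_prob a0 ltxx.
by rewrite integral_dirac// diracT mul1e subee.
Qed.

Let J_ge0 : 0 <= J.
Proof. by apply: integral_ge0 => x _; rewrite mule_ge0// lee_fin. Qed.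

Let a_ge0 : (0 <= a)%R.
Proof. by apply: fine_ge0; apply: integral_ge0 => o _; rewrite lee_fin. Qed.

Let min1V_ge0 (c : R) : (0 <= c)%R -> (0 <= min1V c)%R.
Proof. by move=> c0; rewrite /min1V; case: ifP => // _; rewrite le_min ler01 invr_ge0. Qed.

Lemma lipschitz_discrepancy (h : nat -> R) : (forall i, `|h i.+1 - h i| <= 1)%R ->
  `|\int[P]_o (h (W o))%:E - \int[poisson_prob a 0]_n (h n)%:E| <=
    (3 * min1V (Num.sqrt a) / k`!%:R)%:E * J.
Proof.
move=> h1; have K0 : (0 <= 3 * min1V (Num.sqrt a))%R.
  by rewrite mulr_ge0 ?min1V_ge0 ?sqrtr_ge0.
have [a0|a0] := eqVneq a 0%R.
  by rewrite discrepancy_mean0// abse0 mule_ge0// lee_fin divr_ge0.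
have a_gt0 : (0 < a)%R by rewrite lt0r a0 a_ge0.
apply: poisson_discrepancy => // L j; apply: stein_diff_le_lip => // i.
exact: trunc_lipschitz.
Qed.

Lemma indicator_discrepancy (B : set nat) :
  `|\int[P]_o (\1_B (W o))%:E - \int[poisson_prob a 0]_n (\1_B n)%:E| <=
    (min1V a / k`!%:R)%:E * J.
Proof.
have h01 i : (0 <= (\1_B i : R) <= 1)%R by rewrite indicE ler0n lern1 leq_b1.
have [a0|a0] := eqVneq a 0%R.
  by rewrite (discrepancy_mean0 \1_B a0) abse0 mule_ge0// lee_fin divr_ge0// min1V_ge0.
have a_gt0 : (0 < a)%R by rewrite lt0r a0 a_ge0.
apply: (poisson_discrepancy (h := \1_B)) => //.
- by rewrite min1V_ge0// ltW.
- move=> i; have /andP[l1 u1] := h01 i; have /andP[l2 u2] := h01 i.+1.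
  by rewrite ler_norml lerBlDr (le_trans u2) ?lerDl// lerBrDr addrC lerBlDr
    (le_trans u1)// lerDr.
- move=> L j; apply: stein_diff_le_01 => // n Ln.
  by rewrite (minn_idPr Ln) minnn.
Qed.

End coupling.

(** * Integrals against laws and the two distance bounds *)

Section laws.
Context d (Om : measurableType d) (R : realType) (Q : probability Om R).
Variable Y : Om -> nat.
Hypothesis mY : measurable_fun setT Y.
Local Open Scope ereal_scope.

Lemma integral_law (h : nat -> R) :
  \int[law Q Y]_n (h n)%:E = \int[Q]_o (h (Y o))%:E.
Proof.
rewrite lawE//.
(* As [law Q Y] is merely a set function, it is recognised as the distribution of a measurable map
   before changing variables. *)
pose mY_mixin := isMeasurableFun.Build _ _ _ _ _ mY.
pose mfY : {mfun Om >-> nat} := HB.pack Y mY_mixin.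
change (\int[distribution Q mfY]_n (h n)%:E = \int[Q]_o (h (Y o))%:E).
rewrite [LHS]integralE [RHS]integralE; congr (_ - _).
  by rewrite [LHS](ge0_integral_distribution mfY)// -funepos_comp.
by rewrite [LHS](ge0_integral_distribution mfY)// -funeneg_comp.
Qed.

Lemma law_indic (B : set nat) : law Q Y B = \int[Q]_o (\1_B (Y o))%:E.
Proof. by rewrite /law /prob unlock. Qed.

End laws.

Theorem theorem3p1 (R : realType) (dX dM dO : measure_display)
  (X : measurableType dX) (M : measurableType dM) (Omega : measurableType dO)
  (mu : probability X R) (m : probability M R) (m_diffuse : diffuse m)
  (P : probability Omega R)
  (XT : nat -> {mfun Omega >-> (X * M)%type}) (N : {mfun Omega >-> nat})
  (tau : nat -> {mfun Omega >-> M})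
  (s : R) (s_gt0 : 0 < s)
  (XT_distr : forall i A, measurable A ->
    distribution P (XT i) A = (mu \x m)%E A)
  (N_distr : forall A, distribution P N A = poisson_prob s 0 A)
  (tau_distr : forall j A, measurable A -> distribution P (tau j) A = m A)
  (indep : mutually_independent P (sources XT N tau))
  (k : nat) (k_gt0 : (0 < k)%N)
  (f : config (X * M)%type -> config (X * M)%type -> bool)
  (f_meas : measurable_fun
    ([set psi : config (X * M)%type | #|` psi| = k] `*` setT)
    (fun q => f q.1 q.2))
  (w : k.-tuple X -> R) (w_meas : measurable_fun setT w)
  (w_ge0 : forall x, 0 <= w x) :
  let F := subset_count k f in
  let eta := poisson_process XT N in
  let W := fun o => F (eta o) in
  let pts := marked_points tau in
  let p := fun x : k.-tuple X => 'E_P[fun o => (f (pts k x o) (eta o))%:R]%E in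
  let lambda := mscale (NngNum (ltW s_gt0)) mu in
  let lambdak := tuple_power lambda k in
  {ae lambdak, forall x, (0 < p x)%E ->
    exists (dQ : measure_display) (Omega' : measurableType dQ)
      (Q : probability Omega' R) (U V : {mfun Omega' >-> nat}),
    [/\ law Q U = law P W,
        law Q (fun o => (1 + V o)%N) =
          cond_law P (fun o => F (pts k x o `|` eta o)%fset)
            [set o | f (pts k x o) (eta o)]
      & ('E_Q[fun o => `|(U o)%:R - (V o)%:R|%R] <= (w x)%:E)%E]} ->
  let EW := 'E_P[fun o => (W o)%:R]%E in
  let alpha := fine EW in
  let Zlaw := poisson_prob alpha 0 in
  [/\ EW = alpha%:E,
      alpha%:E = ((k`!%:R^-1)%:E * \int[lambdak]_x p x)%E,
      (dTV (law P W) Zlaw <=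
        (min1V alpha / k`!%:R)%:E * \int[lambdak]_x ((w x)%:E * p x))%E
    & (dW (law P W) Zlaw <=
        (3 * min1V (Num.sqrt alpha) / k`!%:R)%:E *
        \int[lambdak]_x ((w x)%:E * p x))%E].
Proof.
move=> F eta W pts p lambda lambdak couplings EW alpha Zlaw.
have [A [mA A0 A_diag]] := m_diffuse.
pose W' := count_version XT N tau k f A.
have mW' : measurable_fun setT W' by exact: measurable_count_version.
have lawW : law P W = law P W'.
  exact: (law_count_version XT_distr tau_distr indep k f mA A0).
have pE : p = tilted_mean P XT N tau f (fun=> 1).
  apply/funext => x; rewrite /p unlock /tilted_mean.
  by apply: eq_integral => o _; rewrite mulr1.
have EWE : EW = (\int[P]_o ((W' o)%:R)%:E)%E.
  rewrite /EW unlock; apply: (integral_good XT_distr tau_distr indep mA A0) => o go.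
  by rewrite /W' count_versionE.
have EWfin : EW \is a fin_num.
  rewrite EWE.
  exact: (mean_count_version_fin s_gt0 XT_distr N_distr tau_distr indep f_meas mA A0 A_diag).
have alphaE : alpha = fine (\int[P]_o ((W' o)%:R)%:E)%E by rewrite -EWE.
(* The couplings and both distances involve the unconditioned count only through its law, so it may
   be replaced by the measurable [W']. *)
rewrite lawW pE in couplings *.
split.
- by rewrite fineK.
- rewrite /alpha fineK// EWE.
  exact: (mean_count_version s_gt0 XT_distr N_distr tau_distr indep f_meas mA A0 A_diag).
- apply: ub_ereal_sup => _ [B _ <-].
  have -> : Zlaw B = (\int[Zlaw]_n (\1_B n)%:E)%E.
    by rewrite integral_indic// setIT.
  rewrite law_indic /Zlaw alphaE (le_trans (lee_abs _))//.
  apply: (indicator_discrepancy XT_distr N_distr tau_distr indep f_meas mA A0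
    A_diag w_meas w_ge0 couplings).
- apply: ub_ereal_sup => _ [h h1 <-].
  rewrite integral_law// /Zlaw alphaE.
  apply: (lipschitz_discrepancy XT_distr N_distr tau_distr indep f_meas mA A0
    A_diag w_meas w_ge0 couplings) => //.
Qed.
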